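(* Let $\alpha=\{+,-\}$ and let $\nu$ be the involution exchanging $+$ and $-$. The (extended) Arnold basic invariants $J_s^+$, $J_s^-$, $St:{P(\alpha,\nu,1)}_s\to\tfrac14\mathbb{Z}$ are finite type invariants of degree $2$. However, they do not provide the universal finite type invariant of degree $2$: the map $(J_s^+,J_s^-,St):{P(\alpha,\nu,1)}_s\to(\tfrac14\mathbb{Z})^3$ is not a universal finite type invariant of degree $2$ on ${P(\alpha,\nu,1)}_s$.
   Context: Signed words. A signed word is a finite word in which every letter occurs exactly twice, together with a sign $|A|\in\{+,-\}$ for each letter $A$. An isomorphism of signed words is a sign-preserving renaming of letters. $P(\alpha,1)$ is the set of isomorphism classes of signed words; the rank is the number of distinct letters. A $\nu$-shift move changes a non-empty signed word $Ax$ ($A$ the first letter) into $xA$ and reverses the sign of $A$. Cyclic equivalence is the equivalence relation generated by isomorphisms and $\nu$-shift moves. Spherical words. To a generic immersed oriented closed curve (only finitely many self-crossings, all transverse double points) on an oriented surface, with a base point away from the double points, one associates a signed word: label the crossings by distinct letters, traverse the curve once from the base point along its orientation and record the letters met. The sign of $A$ is $-$ if, at the crossing $A$ with both branches drawn directed upward, the branch traversed first goes from bottom-left to top-right (i.e. (first tangent, second tangent) is a positively oriented frame), and $+$ otherwise. ${P(\alpha,1)}_s\subset P(\alpha,1)$ is the set of signed words arising from pointed generic curves on the oriented 2-sphere (it is closed under $\nu$-shift moves). ${P(\alpha,\nu,1)}_s$ is the union of the set of cyclic equivalence classes of elements of ${P(\alpha,1)}_s$ and of the set $P(\alpha,1)\setminus{P(\alpha,1)}_s$.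 Thus an invariant $u:{P(\alpha,\nu,1)}_s\to G$ with values in an abelian group $G$ is a map $u:P(\alpha,1)\to G$ taking equal values on cyclically equivalent elements of ${P(\alpha,1)}_s$. Finite type invariants. A singular signed word is a signed word some of whose letters (written $A^*$) are marked as singular. An invariant $u$ extends to singular signed words by $\hat u=u$ on words without singular letters and $\hat u(xA^*yA^*z)=\hat u(xAyAz)-\hat u(xyz)$, where $A$ is a non-singular letter with the same sign as $A^*$. The invariant $u$ is of finite type if there is $m\ge0$ such that $\hat u(p)=0$ for all $p$ with more than $m$ singular letters; the minimal such $m$ is its degree. A finite type invariant $u:{P(\alpha,\nu,1)}_s\to G$ of degree $m$ is universal if for every abelian group $H$ and every finite type invariant $v:{P(\alpha,\nu,1)}_s\to H$ of degree at most $m$ there is a homomorphism $f:G\to H$ with $v=f\circ u$. Arnold invariants. A subword $w'\triangleleft w$ is obtained from $w$ by deleting both occurrences of each letter in some (possibly empty) set of letters (one subword for each subset of letters). For a Gauss word $v$ (each letter occurring twice, no signs) and a signed word $w$ put $\langle\langle v,w\rangle\rangle=\sum_{w'}\prod_{A\text{ in }w',\,|A|=-}(-1)$, where $w'$ runs over the subwords of $w$ which, forgetting signs, are isomorphic to $v$ (i.e. equal to $v$ up to renaming letters); extend linearly in $v$. Also $\langle[AA],w\rangle$ is the number of subwords of $w$ of rank 1 (so it equals $\mathrm{rank}(w)$). Then $$J_s^+(w)=\langle\langle AABB-ABBA-3ABAB,w\rangle\rangle-\tfrac12\langle[AA],w\rangle+\tfrac12,$$ $$J_s^-(w)=\langle\langle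 AABB-ABBA-3ABAB,w\rangle\rangle-\tfrac32\langle[AA],w\rangle+\tfrac12,$$ $$St(w)=\tfrac12\langle\langle-AABB+ABBA+ABAB,w\rangle\rangle+\tfrac14\langle[AA],w\rangle-\tfrac14.$$ *)

(* Defs.v *)
From HB Require Import structures.
From mathcomp Require Import all_boot all_order all_algebra finmap.
From mathcomp Require Import boolp classical_sets functions cardinality reals.
From mathcomp Require Import topology normedtype derive ring.

Set Implicit Arguments.
Unset Strict Implicit.
Unset Printing Implicit Defensive.

Import Order.TTheory GRing.Theory Num.Theory numFieldNormedType.Exports.
Local Open Scope ring_scope.
Local Open Scope classical_set_scope.

Definition gauss (w : seq nat) : bool := all (fun a => count_mem a w == 2%N) w.

(* Letters are natural numbers; [minus w a] says |a| = -, so that the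
   involution nu on signs is [negb].  The values of [minus w] outside the
   letters of [w] are irrelevant: [isomorphic] ignores them, and P(alpha, 1) is
   [signed_word] up to [isomorphic]. *)
Record signed_word := SignedWord {
  word : seq nat;
  minus : nat -> bool;
  gauss_word : gauss word }.

Definition letters (w : signed_word) : {fset nat} := [fset a in word w]%fset.

Definition rank (w : signed_word) : nat := #|` letters w|%fset.

Definition renaming (v v' : seq nat) : Prop :=
  exists2 f : nat -> nat, {in v &, injective f} & v' = map f v.

Definition isomorphic (w w' : signed_word) : Prop :=
  exists f : nat -> nat, [/\ {in word w &, injective f},
    word w' = map f (word w) &
    {in word w, forall a, minus w' (f a) = minus w a}].

Definition nu_shift (w w' : signed_word) : Prop :=
  exists a x, [/\ word w = a :: x, word w' = rcons x a &
    {in word w, forall b,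
      minus w' b = if b == a then ~~ minus w b else minus w b}].

Inductive cyclic_equiv : signed_word -> signed_word -> Prop :=
| cyclic_iso w w' : isomorphic w w' -> cyclic_equiv w w'
| cyclic_shift w w' : nu_shift w w' -> cyclic_equiv w w'
| cyclic_sym w w' : cyclic_equiv w w' -> cyclic_equiv w' w
| cyclic_trans w w' w'' :
    cyclic_equiv w w' -> cyclic_equiv w' w'' -> cyclic_equiv w w''.

Lemma gauss_filter (p : pred nat) (w : seq nat) :
  gauss w -> gauss (seq.filter p w).
Proof.
move=> /allP gw; apply/allP => a; rewrite mem_filter => /andP[pa /gw /eqP <-].
rewrite count_filter; apply/eqP/eq_count => b /=.
by case: eqP => // ->.
Qed.

Definition delete (D : seq nat) (w : signed_word) : signed_word :=
  SignedWord (minus w)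
    (gauss_filter (fun a => a \notin D) (gauss_word w)).

Section Spherical.
Variable R : realType.
Implicit Types (gamma : R -> 'rV[R]_3) (s t : R).

(* Closed curves are 1-periodic maps with base point gamma 0, so crossings are
   counted over the parameters in [0, 1[. *)
Definition double gamma s t : Prop :=
  [/\ 0 <= s < 1, 0 <= t < 1, s != t & gamma s = gamma t].

Definition velocity gamma t : 'rV[R]_3 := derive1 gamma t.

Record pointed_generic_curve gamma : Prop := PointedGenericCurve {
  curve_smooth : forall n t, derivable (gamma^`(n)) t 1;
  curve_closed : forall t, gamma (t + 1) = gamma t;
  curve_sphere : forall t, \sum_i (gamma t 0 i) ^+ 2 = 1;
  curve_immersed : forall t, velocity gamma t != 0;
  curve_finite : finite_set [set t | exists s, double gamma s t];
  curve_double : forall s t u, double gamma s t -> double gamma s u -> t = u;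
  curve_transverse : forall s t, double gamma s t ->
    row_free (col_mx (velocity gamma s) (velocity gamma t));
  curve_base : ~ exists s, double gamma s 0 }.

(* The area form of the unit sphere at p for the outward normal: it is positive
   on the positively oriented frames (v, w) of the tangent plane at p. *)
Definition area (p v w : 'rV[R]_3) : R :=
  \det (\matrix_(i < 3) nth 0 [:: p; v; w] i).

(* [ts] lists the parameters of the crossings in the order of traversal. *)
Definition reads gamma (w : signed_word) : Prop :=
  exists ts : seq R, [/\ sorted <%R ts,
    forall t, t \in ts <-> exists s, double gamma s t,
    size ts = size (word w),
    forall i j, (i < size ts)%N -> (j < size ts)%N ->
      (nth 0%N (word w) i = nth 0%N (word w) j <->
       gamma ts`_i = gamma ts`_j) &
    forall i j, (i < j < size ts)%N ->
      nth 0%N (word w) i = nth 0%N (word w) j ->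
      minus w (nth 0%N (word w) i) =
        (0 < area (gamma ts`_i) (velocity gamma ts`_i)
                  (velocity gamma ts`_j))].

Definition spherical (w : signed_word) : Prop :=
  exists2 gamma, pointed_generic_curve gamma & reads gamma w.

(* u induces a map on P(alpha, nu, 1)_s. *)
Definition invariant (G : zmodType) (u : signed_word -> G) : Prop :=
  (forall w w', isomorphic w w' -> u w = u w') /\
  (forall w w', spherical w -> spherical w' -> cyclic_equiv w w' ->
     u w = u w').

End Spherical.

(* A singular signed word is a signed word w with a duplicate-free list [sing]
   of letters of w; the value does not depend on the order of the list. *)
Fixpoint sing_ext (G : zmodType) (u : signed_word -> G) (sing : seq nat)
    (w : signed_word) : G :=
  if sing is a :: sing' then
    sing_ext u sing' w - sing_ext u sing' (delete [:: a] w)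
  else u w.

Definition degree_at_most (G : zmodType) (u : signed_word -> G) (m : nat) :
    Prop :=
  forall (w : signed_word) (sing : seq nat),
    uniq sing -> {subset sing <= word w} -> (m < size sing)%N ->
    sing_ext u sing w = 0.

Definition has_degree (G : zmodType) (u : signed_word -> G) (m : nat) : Prop :=
  degree_at_most u m /\ forall k, degree_at_most u k -> (m <= k)%N.

Definition finite_type_invariant (R : realType) (G : zmodType)
    (u : signed_word -> G) (m : nat) : Prop :=
  invariant R u /\ has_degree u m.

(* Meant for u a finite type invariant of degree m; this is not repeated here,
   so that its negation is about the factorization only. *)
Definition universal (R : realType) (G : zmodType) (u : signed_word -> G)
    (m : nat) : Prop :=
  forall (H : zmodType) (v : signed_word -> H),
    invariant R v -> degree_at_most v m ->
    exists f : {additive G -> H}, forall w, v w = f (u w).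

Definition sign_prod (w : signed_word) : int :=
  \prod_(a <- letters w | minus w a) (-1).

(* <<v, w>>, summed over the sets S of deleted letters. *)
Definition pairing (v : seq nat) (w : signed_word) : int :=
  \sum_(S <- fpowerset (letters w) | `[< renaming v (word (delete S w)) >])
     sign_prod (delete S w).

(* <[AA], w>: the number of subwords of rank 1. *)
Definition pairing_AA (w : signed_word) : int :=
  \sum_(S <- fpowerset (letters w) | rank (delete S w) == 1%N) 1.

Definition AABB : seq nat := [:: 0; 0; 1; 1]%N.
Definition ABBA : seq nat := [:: 0; 1; 1; 0]%N.
Definition ABAB : seq nat := [:: 0; 1; 0; 1]%N.

Definition quarter_int : {pred rat} := fun x => 4 * x \is a Num.int.

Lemma quarter_int_zmod : zmod_closed quarter_int.
Proof.
split=> [|x y]; rewrite -!topredE /= /quarter_int ?mulr0 ?rpred0 //.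
by rewrite mulrBr => hx hy; apply: rpredB.
Qed.

HB.instance Definition _ :=
  GRing.isZmodClosed.Build rat quarter_int quarter_int_zmod.

Record quarterZ := QuarterZ { qval :> rat; qvalP : qval \in quarter_int }.

HB.instance Definition _ := [isSub for qval].
HB.instance Definition _ := [Choice of quarterZ by <:].
HB.instance Definition _ := [SubChoice_isSubZmodule of quarterZ by <:].

Lemma quarter_int_comb (x : rat) (k : int) :
  4 * x = k%:~R -> x \in quarter_int.
Proof. by move=> xk; rewrite -topredE /= /quarter_int xk intr_int. Qed.

Definition Jplus_rat (w : signed_word) : rat :=
  (pairing AABB w - pairing ABBA w - 3 * pairing ABAB w)%:~R
  - 1 / 2 * (pairing_AA w)%:~R + 1 / 2.

Definition Jminus_rat (w : signed_word) : rat :=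
  (pairing AABB w - pairing ABBA w - 3 * pairing ABAB w)%:~R
  - 3 / 2 * (pairing_AA w)%:~R + 1 / 2.

Definition St_rat (w : signed_word) : rat :=
  1 / 2 * (- pairing AABB w + pairing ABBA w + pairing ABAB w)%:~R
  + 1 / 4 * (pairing_AA w)%:~R - 1 / 4.

Lemma Jplus_quarter w : Jplus_rat w \in quarter_int.
Proof.
apply: (@quarter_int_comb _ (4 * (pairing AABB w - pairing ABBA w
  - 3 * pairing ABAB w) - 2 * pairing_AA w + 2)).
by rewrite /Jplus_rat; field.
Qed.

Lemma Jminus_quarter w : Jminus_rat w \in quarter_int.
Proof.
apply: (@quarter_int_comb _ (4 * (pairing AABB w - pairing ABBA w
  - 3 * pairing ABAB w) - 6 * pairing_AA w + 2)).
by rewrite /Jminus_rat; field.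
Qed.

Lemma St_quarter w : St_rat w \in quarter_int.
Proof.
apply: (@quarter_int_comb _ (2 * (- pairing AABB w + pairing ABBA w
  + pairing ABAB w) + pairing_AA w - 1)).
by rewrite /St_rat; field.
Qed.

Definition Jplus (w : signed_word) : quarterZ := QuarterZ (Jplus_quarter w).
Definition Jminus (w : signed_word) : quarterZ := QuarterZ (Jminus_quarter w).
Definition St (w : signed_word) : quarterZ := QuarterZ (St_quarter w).

Definition arnold (w : signed_word) : quarterZ * quarterZ * quarterZ :=
  (Jplus w, Jminus w, St w).

(* Main.v *)
From mathcomp Require Import all_boot all_order all_algebra finmap.
From mathcomp Require Import boolp classical_sets functions reals.
From mathcomp Require Import topology normedtype derive ring lra zify.
Require Import Defs.

(** A shift of the first letter [c] of [w] preserves <<AABB - ABBA, w>> and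
    <[AA], w>, and adds [- 2 |c| n(c)] to <<ABAB, w>>, where [n(a)] is the sum of
    the signs of the letters linked with [a], negated for those whose first
    occurrence precedes that of [a]; up to sign, the numbers [n(a)] do not change.
    If [w] is read along a curve on the sphere, [n(a)] is up to sign the
    intersection number of the two loops into which the crossing [a] cuts the
    curve, hence [0].

    To see this, project the curve stereographically to a plane curve [f], from a
    point of the sphere that it misses.  Let [p] and [q] run along the two loops,
    and cut the rectangle of all [(p, q)] into small cells.  The rotation numbers
    of [f p - f q] around the cells add up to [0]: inner sides cancel, and so do
    opposite sides of the rectangle since the loops are closed.  The number of a
    cell is, up to a global sign, the sign of the crossing it contains, if any.

    The invariants are sums over subwords of rank at most 2, which bounds their
    degree.  The constant [1 : int] does not factor through the Arnold invariants,
    because these are all divisible by 4 in [quarterZ] at the word [AA]. *)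

Set Implicit Arguments.
Unset Strict Implicit.
Unset Printing Implicit Defensive.

Import Order.TTheory GRing.Theory Num.Theory numFieldNormedType.Exports.
Local Open Scope ring_scope.

(** * Rotation numbers of closed polygons *)

Section Hit.
Variable R : realFieldType.
Implicit Types u v w : R * R.

Definition cross u v : R := u.1 * v.2 - u.2 * v.1.

Definition upper u : bool := 0 <= u.2.

(* The signed number of crossings of the segment [u, v] with the ray
   [{(x, 0) | 0 < x}]; a point of the ray counts as above it. *)
Definition hit u v : int :=
  if [&& ~~ upper u, upper v & 0 < cross u v] then 1
  else if [&& upper u, ~~ upper v & cross u v < 0] then -1 else 0.

(** If no side meets the origin, this is the winding number about the origin of the closed
    quadrilateral. *)
Definition turn (a b c d : R * R) : int := hit a b + hit b c + hit c d + hit d a.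

Lemma hitC u v : hit v u = - hit u v.
Proof.
rewrite /hit; have -> : cross v u = - cross u v by rewrite /cross; ring.
rewrite oppr_gt0 oppr_lt0.
by case: (upper u); case: (upper v) => //=; case: ifP; rewrite ?oppr0 ?opprK.
Qed.

(** If [0 < al], the half-plane contains the ray but not the opposite one, so crossing the axis
    means crossing the ray and [upper] is a potential. Otherwise it misses the ray and [hit]
    vanishes. Around a closed polygon the potential differences cancel. *)
Lemma hit_half_plane (al be : R) : exists g : R * R -> int, forall u v,
  0 < al * u.1 + be * u.2 -> 0 < al * v.1 + be * v.2 -> hit u v = g v - g u.
Proof.
have [al0|al0] := ltP 0 al.
  exists (fun u => (upper u)%:Z) => -[x y] [x' y'] /=.
  rewrite /hit /upper /cross /=.
  case: (leP 0 y) => hy; case: (leP 0 y') => hy' //= h1 h2.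
  - suff -> : x * y' - y * x' < 0 by rewrite sub0r.
    have : 0 < al * (y * x' - x * y').
      have h3 : y * (al * x' + be * y') >= 0 by rewrite mulr_ge0 ?(ltW h1) ?(ltW h2).
      have h4 : - y' * (al * x + be * y) > 0 by rewrite mulr_gt0 // oppr_gt0.
      lra.
    by rewrite pmulr_rgt0 //; lra.
  - suff -> : 0 < x * y' - y * x' by rewrite subr0.
    have : 0 < al * (x * y' - y * x').
      have h3 : y' * (al * x + be * y) >= 0 by rewrite mulr_ge0 ?(ltW h1) ?(ltW h2).
      have h4 : - y * (al * x' + be * y') > 0 by rewrite mulr_gt0 // oppr_gt0.
      lra.
    by rewrite pmulr_rgt0.
exists (fun=> 0) => -[x y] [x' y'] /= h1 h2.
rewrite /hit /upper /cross /= subr0.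
case: (leP 0 y) => hy; case: (leP 0 y') => hy' //=; case: ifP => // h; exfalso.
- have h3 : y * (al * x' + be * y') >= 0 by rewrite mulr_ge0 ?(ltW h1) ?(ltW h2).
  have h4 : - y' * (al * x + be * y) > 0 by rewrite mulr_gt0 // oppr_gt0.
  have : al * (y * x' - x * y') <= 0 by rewrite mulr_le0_ge0 //; lra.
  lra.
- have h3 : y' * (al * x + be * y) >= 0 by rewrite mulr_ge0 ?(ltW h1) ?(ltW h2).
  have h4 : - y * (al * x' + be * y') > 0 by rewrite mulr_gt0 // oppr_gt0.
  have : al * (x * y' - y * x') <= 0 by rewrite mulr_le0_ge0 //; lra.
  lra.
Qed.

Lemma turn_half_plane (al be : R) (a b c d : R * R) :
  0 < al * a.1 + be * a.2 -> 0 < al * b.1 + be * b.2 ->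
  0 < al * c.1 + be * c.2 -> 0 < al * d.1 + be * d.2 -> turn a b c d = 0.
Proof.
move=> ha hb hc hd; have [g hg] := hit_half_plane al be.
by rewrite /turn !hg //; ring.
Qed.

(** [X w] and [Y w] are the coordinates of [w] in the basis [u], [v]. The polygon visits the four
    open quadrants of this basis, clockwise if the basis is positive. *)
Lemma turn_quadrants u v (a b c d : R * R) :
  let X w := cross w v / cross u v in let Y w := cross u w / cross u v in
  cross u v != 0 ->
  X a < 0 -> 0 < Y a -> 0 < X b -> 0 < Y b ->
  0 < X c -> Y c < 0 -> X d < 0 -> Y d < 0 ->
  turn a b c d = if 0 < cross u v then -1 else 1.
Proof.
move=> X Y D0 Xa Ya Xb Yb Xc Yc Xd Yd.
have crossE w w' : cross w w' = (X w * Y w' - Y w * X w') * cross u v.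
  rewrite /X /Y /cross in D0 *; field; exact: D0.
have sndE w : w.2 = X w * u.2 + Y w * v.2.
  rewrite /X /Y /cross in D0 *; field; exact: D0.
have uv0 : (u.2 != 0) || (v.2 != 0).
  by apply: contraNT D0; rewrite negb_or !negbK /cross => /andP[/eqP-> /eqP->];
     rewrite mul0r mulr0 subr0.
clearbody X Y.
rewrite /turn /hit (crossE a b) (crossE b c) (crossE c d) (crossE d a) /upper.
rewrite (sndE a) (sndE b) (sndE c) (sndE d).
have neg (p q r s : R) : p * q < 0 -> 0 < r * s -> p * q - r * s < 0 by lra.
have ab : X a * Y b - Y a * X b < 0 by apply: neg; rewrite ?nmulr_rlt0 ?mulr_gt0.
have bc : X b * Y c - Y b * X c < 0 by apply: neg; rewrite ?pmulr_rlt0 ?mulr_gt0.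
have cd : X c * Y d - Y c * X d < 0 by apply: neg; rewrite ?pmulr_rlt0 ?nmulr_rgt0.
have da : X d * Y a - Y d * X a < 0 by apply: neg; rewrite ?nmulr_rlt0 ?nmulr_rgt0.
move: (X a) (Y a) (X b) (Y b) (X c) (Y c) (X d) (Y d) Xa Ya Xb Yb Xc Yc Xd Yd
  ab bc cd da {crossE sndE} => xa ya xb yb xc yc xd yd Xa Ya Xb Yb Xc Yc Xd Yd
  ab bc cd da.
have tr (x y : R) : 0 <= x * u.2 -> 0 <= y * v.2 -> 0 <= x * u.2 + y * v.2.
  exact: addr_ge0.
have fl (x y : R) : x != 0 -> y != 0 -> x * u.2 <= 0 -> y * v.2 <= 0 ->
    (0 <= x * u.2 + y * v.2) = false.
  move=> x0 y0 hx hy; apply/negP => h.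
  have [/eqP] : x * u.2 = 0 /\ y * v.2 = 0 by lra.
  rewrite mulf_eq0 (negbTE x0) => /= /eqP hu /eqP.
  by rewrite mulf_eq0 (negbTE y0) => /= hv; rewrite hu hv eqxx in uv0.
have [xa0 ya0 xb0 yb0] : [/\ xa != 0, ya != 0, xb != 0 & yb != 0].
  by rewrite lt_eqF ?gt_eqF.
have [xc0 yc0 xd0 yd0] : [/\ xc != 0, yc != 0, xd != 0 & yd != 0].
  by rewrite gt_eqF // lt_eqF // lt_eqF // lt_eqF.
(* All four sides turn the same way, so either only falls out of [upper] are counted, or only rises
   into it. Two opposite vertices on different sides of the axis force exactly one of each. *)
have sgn : [|| [&& 0 <= xb * u.2 + yb * v.2 & ~~ (0 <= xd * u.2 + yd * v.2)],
   [&& 0 <= xc * u.2 + yc * v.2 & ~~ (0 <= xa * u.2 + ya * v.2)],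
   [&& 0 <= xa * u.2 + ya * v.2 & ~~ (0 <= xc * u.2 + yc * v.2)] |
   [&& 0 <= xd * u.2 + yd * v.2 & ~~ (0 <= xb * u.2 + yb * v.2)]].
  have [xa1 yb1 xd1 yc1] := And4 (ltW Xa) (ltW Yb) (ltW Xd) (ltW Yc).
  have [ya1 xb1 yd1 xc1] := And4 (ltW Ya) (ltW Xb) (ltW Yd) (ltW Xc).
  have [hu|/ltW hu] := leP 0 u.2; have [hv|/ltW hv] := leP 0 v.2.
  - have -> := tr _ _ (mulr_ge0 xb1 hu) (mulr_ge0 yb1 hv).
    by have -> := fl _ _ xd0 yd0 (mulr_le0_ge0 xd1 hu) (mulr_le0_ge0 yd1 hv).
  - have -> := tr _ _ (mulr_ge0 xc1 hu) (mulr_le0 yc1 hv).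
    have -> := fl _ _ xa0 ya0 (mulr_le0_ge0 xa1 hu) (mulr_ge0_le0 ya1 hv).
    by rewrite orbT.
  - have -> := tr _ _ (mulr_le0 xa1 hu) (mulr_ge0 ya1 hv).
    have -> := fl _ _ xc0 yc0 (mulr_ge0_le0 xc1 hu) (mulr_le0_ge0 yc1 hv).
    by rewrite !orbT.
  - have -> := tr _ _ (mulr_le0 xd1 hu) (mulr_le0 yd1 hv).
    have -> := fl _ _ xb0 yb0 (mulr_ge0_le0 xb1 hu) (mulr_ge0_le0 yb1 hv).
    by rewrite !orbT.
have [D1|D1] := ltP 0 (cross u v).
  rewrite !(pmulr_lgt0 _ D1) !(pmulr_llt0 _ D1) ab bc cd da.
  rewrite !(lt_gtF ab) !(lt_gtF bc) !(lt_gtF cd) !(lt_gtF da) !andbF !andbT.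
  move: sgn; do 4!case: (0 <= _) => //=.
have {}D1 : cross u v < 0 by rewrite lt_neqAle D0.
rewrite !(nmulr_lgt0 _ D1) !(nmulr_llt0 _ D1) ab bc cd da.
rewrite !(lt_gtF ab) !(lt_gtF bc) !(lt_gtF cd) !(lt_gtF da) !andbF !andbT.
by move: sgn; do 4!case: (0 <= _) => //=.
Qed.
End Hit.

Local Open Scope classical_set_scope.

(** * Intersections of two loops in the plane *)

Lemma is_derive_near (R : realType) (g : R -> R) (x l e : R) :
  is_derive x 1 g l -> 0 < e ->
  \forall y \near x, `|g y - g x - l * (y - x)| <= e * `|y - x|.
Proof.
move=> [dg <-] e0; have /cvgrPdist_le/(_ _ e0) := dg.
rewrite /derive => /nbhs_ballP[d /= d0 H]; apply/nbhs_ballP; exists d => //= y.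
rewrite /ball /= => xy; have [->|yx] := eqVneq y x.
  by rewrite !subrr mulr0 subr0 normr0 mulr0.
have yx0 : y - x != 0 by rewrite subr_eq0.
have := H (y - x); rewrite /ball /= sub0r normrN distrC => /(_ xy yx0).
rewrite /shift /= -[_ *: (1 : R)]/(_ * _) mulr1 subrK.
set D := lim _; rewrite -[_ *: _]/(_ * _).
rewrite -(ler_pM2r (_ : 0 < `|y - x|)) ?normr_gt0// -normrM mulrBl.
rewrite mulrAC mulVf// mul1r => h.
by rewrite (distrC x) (distrC (g y - g x)); move: h; congr (_ <= _).
Qed.

(** * Cells near a crossing *)

Section OffCell.
Variable R : realType.

Definition steep (A B : R -> R) (a b : R) := forall x, a <= x <= b ->
  `|A x - x| <= 10^-1 * `|x| /\ `|B x| <= 10^-1 * `|x|.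

(* Near a crossing [(p0, q0)], the coordinates of [f p - f q] in the basis of the
   two velocities are [A x - B y] and [K x - L y], where [x = p - p0] and
   [y = q - q0]. *)
Lemma off_right (A K B L : R -> R) (e a b c d : R) :
  0 < e -> e <= a -> b <= a + 2 * e -> d <= c + 2 * e ->
  steep A K a b -> steep L B c d ->
  exists al be, forall x y, a <= x <= b -> c <= y <= d ->
    0 < al * (A x - B y) + be * (K x - L y).
Proof.
move=> e0 ea ba dc hx hy.
(* Since [e <= a], the cell has [a <= x <= 3 * a] and height at most [2 * a]. If [|y| <= 4 * a] on
   the cell, the first coordinate is positive. Otherwise [|y| > 2 * a] throughout, and the second
   coordinate has the sign of [- y]. *)
have [d4|d4] := leP d (4 * a); have [c4|c4] := leP (- (4 * a)) c.
- exists 1, 0 => x y xab ycd; have [h1 h2] := hx _ xab; have [h3 h4] := hy _ ycd.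
  have ny : `|y| <= 4 * a by rewrite ler_norml; lra.
  have x0 : 0 <= x by lra.
  move: h1 h4; rewrite (ger0_norm x0) !ler_norml => h1 h4; lra.
- exists 0, 1 => x y xab ycd; have [h1 h2] := hx _ xab; have [h3 h4] := hy _ ycd.
  have x0 : 0 <= x by lra.
  have y0 : y <= 0 by lra.
  move: h2 h3; rewrite (ger0_norm x0) (ler0_norm y0) !ler_norml => h2 h3; lra.
- exists 0, (-1) => x y xab ycd; have [h1 h2] := hx _ xab; have [h3 h4] := hy _ ycd.
  have x0 : 0 <= x by lra.
  have y0 : 0 <= y by lra.
  move: h2 h3; rewrite (ger0_norm x0) (ger0_norm y0) !ler_norml => h2 h3; lra.
- exists 0, 1 => x y xab ycd; lra.
Qed.

Lemma steep_opp A B a b :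
  steep A B a b -> steep (fun x => - A (- x)) (fun x => - B (- x)) (- b) (- a).
Proof.
move=> h x xba; have [|h1 h2] := h (- x); first lra.
by move: h1 h2; rewrite !normrN opprK -opprD normrN.
Qed.

Lemma off_left (A K B L : R -> R) (e a b c d : R) :
  0 < e -> b <= - e -> b <= a + 2 * e -> d <= c + 2 * e ->
  steep A K a b -> steep L B c d ->
  exists al be, forall x y, a <= x <= b -> c <= y <= d ->
    0 < al * (A x - B y) + be * (K x - L y).
Proof.
move=> e0 be ba dc hx hy.
have [|||al [be' h]] := off_right e0 _ _ _ (steep_opp hx) (steep_opp hy).
- lra.
- lra.
- lra.
exists (- al), (- be') => x y xab ycd.
have := h (- x) (- y); rewrite !opprK => h1.
have : 0 < al * (- A x + B y) + be' * (- K x + L y) by apply: h1; lra.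
by congr (0 < _); ring.
Qed.

(** The last two cases come from exchanging the loops, which reverses the difference and swaps its
    coordinates; hence the form [(- be, - al)]. *)
Lemma off_cell (A K B L : R -> R) (e a b c d : R) :
  0 < e -> [\/ e <= a, b <= - e, e <= c | d <= - e] ->
  b <= a + 2 * e -> d <= c + 2 * e ->
  steep A K a b -> steep L B c d ->
  exists al be, forall x y, a <= x <= b -> c <= y <= d ->
    0 < al * (A x - B y) + be * (K x - L y).
Proof.
move=> e0 [ea|be|ec|de] ba dc hx hy.
- exact: off_right ea ba dc hx hy.
- exact: off_left be ba dc hx hy.
- have [al [be h]] := off_right e0 ec dc ba hy hx.
  exists (- be), (- al) => x y xab ycd; have := h _ _ ycd xab.
  by congr (0 < _); ring.
- have [al [be h]] := off_left e0 de dc ba hy hx.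
  exists (- be), (- al) => x y xab ycd; have := h _ _ ycd xab.
  by congr (0 < _); ring.
Qed.

(** Both [|x|] and [|y|] are at most a tenth of [|x| + |y|]. So a crossing is the only coincidence
    in its neighbourhood. *)
Lemma steep_inj (A K B L : R -> R) (a b c d x y : R) :
  steep A K a b -> steep L B c d -> a <= x <= b -> c <= y <= d ->
  A x = B y -> K x = L y -> x = 0 /\ y = 0.
Proof.
move=> hx hy /hx[Ax Kx] /hy[Ly By] AB KL.
have h1 : `|x| <= 10^-1 * `|x| + 10^-1 * `|y|.
  have := ler_normD (A x) (x - A x); rewrite subrKC distrC => h.
  apply: le_trans h _; rewrite addrC lerD//; by rewrite AB.
have h2 : `|y| <= 10^-1 * `|y| + 10^-1 * `|x|.
  have := ler_normD (L y) (y - L y); rewrite subrKC distrC => h.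
  apply: le_trans h _; rewrite addrC lerD//; by rewrite -KL.
have [x0 y0] := (normr_ge0 x, normr_ge0 y).
by split; apply/normr0_eq0; lra.
Qed.

(** At a corner [(x, y)] of the square centred at the crossing, the coordinates are [x] and [- y] up
    to [h / 5], so the corners lie in the four quadrants. *)
Lemma turn_steep (A K B L : R -> R) (h : R) (u v wa wb wc wd : R * R) :
  let coords w x y := cross w v / cross u v = A x - B y /\
                      cross u w / cross u v = K x - L y in
  cross u v != 0 -> 0 < h -> steep A K (- h) h -> steep L B (- h) h ->
  coords wa (- h) (- h) -> coords wb h (- h) ->
  coords wc h h -> coords wd (- h) h ->
  turn wa wb wc wd = if 0 < cross u v then -1 else 1.
Proof.
move=> coords D0 h0 hx hy [a1 a2] [b1 b2] [c1 c2] [d1 d2].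
have [|A1 K1] := hx (- h); first lra.
have [|A2 K2] := hx h; first lra.
have [|L1 B1] := hy (- h); first lra.
have [|L2 B2] := hy h; first lra.
move: A1 K1 A2 K2 L1 B1 L2 B2; rewrite normrN (gtr0_norm h0) !ler_norml.
move=> A1 K1 A2 K2 L1 B1 L2 B2.
by apply: turn_quadrants => //; rewrite ?a1 ?a2 ?b1 ?b2 ?c1 ?c2 ?d1 ?d2; lra.
Qed.

End OffCell.

(** * Subdivisions of an interval adapted to marked points *)

Section Chains.
Variable R : realType.
Implicit Types (x y h : R) (l M : seq R) (P : R -> R -> Prop) (g : R -> R -> int).

Fixpoint psum g x l : int := if l is y :: l' then g x y + psum g y l' else 0.

Lemma psum_telescope (g : R -> int) x l :
  psum (fun a b => g b - g a) x l = g (last x l) - g x.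
Proof. by elim: l x => [|y l IH] x /=; rewrite ?subrr// IH; ring. Qed.

Lemma psumD g g' x l :
  psum (fun a b => g a b + g' a b) x l = psum g x l + psum g' x l.
Proof. by elim: l x => [|y l IH] x /=; rewrite ?addr0// IH; ring. Qed.

Lemma psumB g g' x l :
  psum (fun a b => g a b - g' a b) x l = psum g x l - psum g' x l.
Proof. by elim: l x => [|y l IH] x /=; rewrite ?subrr// IH; ring. Qed.

Lemma psumZ k g x l : psum (fun a b => k * g a b) x l = k * psum g x l.
Proof. by elim: l x => [|y l IH] x /=; rewrite ?mulr0// IH mulrDr. Qed.

Lemma psum_sum (T : Type) (X : seq T) (g : T -> R -> R -> int) x l :
  psum (fun a b => \sum_(z <- X) g z a b) x l = \sum_(z <- X) psum (g z) x l.
Proof.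
elim: l x => [|y l IH] x /=; first by rewrite big1.
by rewrite IH -big_split.
Qed.

(** [path] for a relation with values in [Prop]. *)
Inductive chain P : R -> seq R -> Prop :=
| chain_nil x : chain P x [::]
| chain_cons x y l : P x y -> chain P y l -> chain P x (y :: l).

Lemma eq_psum P g g' x l : chain P x l ->
  (forall a b, P a b -> g a b = g' a b) -> psum g x l = psum g' x l.
Proof. by move=> c E; elim: c => //= {}x y {}l xy _ ->; rewrite (E _ _ xy). Qed.

Lemma sub_chain P P' x l : (forall a b, P a b -> P' a b) ->
  chain P x l -> chain P' x l.
Proof. by move=> PP'; elim=> *; constructor; auto. Qed.

Lemma chain_cat P x l l' :
  chain P x l -> chain P (last x l) l' -> chain P x (l ++ l').
Proof. by elim=> //= {}x y {}l xy _ IH /IH; exact: chain_cons. Qed.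

(** The bound [2 * h] is the width of the interval centred at a marked point. *)
Definition step h x y a b := [/\ a < b <= a + 2 * h, x <= a & b <= y].

Lemma fine_chain h x y : 0 < h -> x <= y ->
  exists2 l, last x l = y & chain (step h x y) x l.
Proof.
move=> h0 xy; have h20 : 0 < 2 * h by lra.
have [n] : exists n : nat, y <= x + n%:R * (2 * h).
  exists (Num.truncn ((y - x) / (2 * h))).+1.
  rewrite -lerBlDl -ler_pdivrMr// ltW//; apply: truncnS_gt.
elim: n => [|n IH] in x xy *.
  move=> yx; exists [::]; last exact: chain_nil.
  by apply/eqP; rewrite eq_le xy; move: yx; rewrite mul0r addr0.
move=> yx; have [yx2|xy2] := leP y (x + 2 * h).
  have [xEy|xNy] := eqVneq x y; first by exists [::] => //; exact: chain_nil.
  exists [:: y] => //; apply: chain_cons; last exact: chain_nil.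
  by split=> //; rewrite lt_neqAle xNy xy.
  have [|l ly cl] := IH (x + 2 * h) (ltW xy2).
    by move: yx; rewrite -natr1; lra.
  exists (x + 2 * h :: l) => //; apply: chain_cons; first by split; lra.
  by apply: sub_chain cl => a b [ab xa by_]; split=> //; lra.
Qed.

(* The intervals of the subdivisions are centered at the crossing parameters [m]
   or stay away from them by their own scale [h]; hence the estimates at a
   crossing do not depend on [h]. *)
Definition compat h m a b := (a = m - h /\ b = m + h) \/ b <= m - h \/ m + h <= a.

(** Starting the path at [x - h] asks the first marked point only to be at distance [h] from [x].
    After the interval around [m] the induction restarts at [m + h], for which this starting value
    is [m]. *)
Lemma marked_chain h x y M : 0 < h ->
  path (fun a b => a + 2 * h <= b) (x - h) (rcons M y) ->
  exists2 l, last x l = y &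
    chain (fun a b => step h x y a b /\ {in M, forall m, compat h m a b}) x l.
Proof.
move=> h0; have tr : transitive (fun a b : R => a + 2 * h <= b) by move=> ? ? ?; lra.
elim: M x => [|m M IH] x /=.
  rewrite andbT => xy; have [|l ly cl] := @fine_chain h x y h0; first lra.
  by exists l => //; apply: sub_chain cl.
move=> /andP[xm pm].
have mM m' : m' \in rcons M y -> m + 2 * h <= m'.
  by move/(order_path_min tr)/allP : pm; apply.
have my : m + 2 * h <= y by apply: mM; rewrite mem_rcons mem_head.
have {}mM m' : m' \in M -> m + 2 * h <= m'.
  by move=> m'M; apply: mM; rewrite mem_rcons inE m'M orbT.
have [|l2 l2y c2] := IH (m + h); first by rewrite addrK.
have [|l1 l1y c1] := @fine_chain h x (m - h) h0; first lra.
exists (l1 ++ m + h :: l2); first by rewrite last_cat.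
apply: chain_cat; [|rewrite l1y; apply: chain_cons].
- apply: sub_chain c1 => a b [ab xa bm]; split; first by split=> //; lra.
  move=> m'; rewrite inE => /orP[/eqP->|/mM]; by rewrite /compat; lra.
- split; first by split; lra.
  move=> m'; rewrite inE => /orP[/eqP->|/mM]; rewrite /compat; [by left|lra].
- apply: sub_chain c2 => a b [[ab xa bm] cM]; split; first by split=> //; lra.
  by move=> m'; rewrite inE => /orP[/eqP->|/cM//]; rewrite /compat; lra.
Qed.

Lemma spaced_near x M : path <%R x M ->
  \forall h \near (0 : R)^'+, path (fun a b => a + 2 * h <= b) x M.
Proof.
elim: M x => [|m M IH] x /=; first by move=> _; exact: nearW.
move=> /andP[xm /IH]; apply: filterS2 (nbhs_right_le (_ : 0 < (m - x) / 2)).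
  by move=> h hm ->; rewrite andbT; lra.
by rewrite divr_gt0// subr_gt0.
Qed.

Lemma marked_chain_near x y M : x < y -> {in M, forall m, x < m < y} ->
  \forall h \near (0 : R)^'+, exists2 l, last x l = y &
    chain (fun a b => step h x y a b /\ {in M, forall m, compat h m a b}) x l.
Proof.
move=> xy Mxy; pose M' := sort <=%R (undup M).
have sM : path <%R x (rcons M' y).
  rewrite rcons_path; apply/andP; split.
    rewrite path_min_sorted; first by rewrite sort_lt_sorted undup_uniq.
    by apply/allP => m; rewrite mem_sort mem_undup => /Mxy/andP[].
  have : last x M' \in x :: M' by exact: mem_last.
  by rewrite inE mem_sort mem_undup => /orP[/eqP->|/Mxy/andP[]].
have h0 := nbhs_right_gt (0 : R).
apply: filterS2 h0 (spaced_near sM) => h h0 pM.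
have [|l ly cl] := @marked_chain h x y M' h0.
  move: pM; case: (rcons M' y) => //= m l /andP[h1 ->]; rewrite andbT; lra.
exists l => //; apply: sub_chain cl => a b [ab cM]; split=> // m mM.
by apply: cM; rewrite mem_sort mem_undup.
Qed.

End Chains.

(** * Counting the crossings of two loops by rotation numbers of cells *)

Section Loops.
Variables (R : realType) (f df : R -> R * R) (s t e : R) (X : seq (R * R)).
Hypothesis df1 : forall x, is_derive x (1 : R) (fun y => (f y).1) (df x).1.
Hypothesis df2 : forall x, is_derive x (1 : R) (fun y => (f y).2) (df x).2.
Hypotheses (fst_eq : f s = f t) (fte : f t = f e) (dfse : df s = df e).
Hypothesis corner : cross (df s) (df t) != 0.
Hypothesis XP : forall p q, s <= p <= t -> t <= q <= e -> f p = f q ->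
  (p, q) \in X \/ p \in [:: s; t] /\ q \in [:: t; e].
Hypothesis Xin : forall z, z \in X ->
  [/\ s < z.1 < t, t < z.2 < e, f z.1 = f z.2 & cross (df z.1) (df z.2) != 0].
Hypothesis Xuniq : uniq X.

Let F p q : R * R := ((f p).1 - (f q).1, (f p).2 - (f q).2).

(* Giving [F] the value [df s - df t] at its zeros makes the cells at the four
   corners of [s, t] x [t, e] ordinary: all values of [G] near such a corner lie
   in the half-plane where the difference of the coordinates in the basis
   [df s], [df t] is positive. *)
Let G p q : R * R :=
  if f p == f q then ((df s).1 - (df t).1, (df s).2 - (df t).2) else F p q.

Let K a b c d := turn (G a c) (G b c) (G b d) (G a d).

Let sg (z : R * R) : int := if 0 < cross (df z.1) (df z.2) then -1 else 1.

(** Half-open intervals put each crossing into exactly one cell of a subdivision. *)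
Let cell_ok a b c d :=
  K a b c d = \sum_(z <- X) sg z * ((a <= z.1 < b) && (c <= z.2 < d))%:R.

Let tame (pr : R * R -> R) (h a b : R) := a < b <= a + 2 * h /\
  forall z, z \in X -> compat h (pr z) a b.

Let inrect a b c d := [/\ s <= a, b <= t, t <= c & d <= e].

Let eqf p q : F p q = (0, 0) -> f p = f q.
Proof.
by rewrite /F => -[/eqP + /eqP]; rewrite !subr_eq0; case: (f p); case: (f q)
  => ? ? ? ? /= /eqP-> /eqP->.
Qed.

Let cell_half_plane al be a b c d : a < b -> c < d ->
  (forall p q, a <= p <= b -> c <= q <= d ->
     0 < al * (G p q).1 + be * (G p q).2) ->
  (forall p q, a <= p <= b -> c <= q <= d -> (p, q) \notin X) ->
  cell_ok a b c d.
Proof.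
move=> ab cd hG hX; rewrite /cell_ok /K (@turn_half_plane _ al be).
- rewrite big1_seq// => -[p q] /= pqX; case: andP => [[/andP[h1 h2] /andP[h3 h4]]|].
    by have := hX p q; rewrite pqX h1 h3 !ltW// => /(_ isT isT).
  by rewrite mulr0.
all: apply: hG; lra.
Qed.

Let phi (al be x : R) := al * (f x).1 + be * (f x).2.

Let phi_near al be x (l k : R) : l = al * (df x).1 + be * (df x).2 -> 0 < k ->
  exists2 r, 0 < r & forall y, `|y - x| < r ->
    `|phi al be y - phi al be x - l * (y - x)| <= k * `|y - x|.
Proof.
move=> -> k0; have dphi : is_derive x (1 : R) (phi al be)
    (al * (df x).1 + be * (df x).2).
  by apply: (@is_deriveD _ _ _ (fun y => al * (f y).1) (fun y => be * (f y).2));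
     apply: is_deriveZ.
have /nbhs_ballP[r /= r0 H] := is_derive_near dphi k0.
by exists r => // y yx; apply: H; rewrite /ball /= distrC.
Qed.

Let GE al be p q : f p <> f q ->
  al * (G p q).1 + be * (G p q).2 = phi al be p - phi al be q.
Proof. by rewrite /G => /eqP/negbTE->; rewrite /F /phi /=; ring. Qed.

(** [P] holds for all cells near [(p0, q0)]; compactness of the rectangle later makes this
    uniform. *)
Let local (p0 q0 : R) (P : R -> R -> R -> R -> Prop) :=
  exists2 r, 0 < r & forall a b c d, inrect a b c d ->
  (forall p, a <= p <= b -> `|p - p0| < r) ->
  (forall q, c <= q <= d -> `|q - q0| < r) -> P a b c d.

Let cell_nonzero p0 q0 : f p0 <> f q0 ->
  local p0 q0 (fun a b c d => a < b -> c < d -> cell_ok a b c d).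
Proof.
(* The form is the scalar product with [F p0 q0], positive there. Near [p0] and [q0] each of the two
   terms moves by less than half of that value. *)
move=> fpq; pose al := (F p0 q0).1; pose be := (F p0 q0).2.
have m0 : 0 < phi al be p0 - phi al be q0.
  have -> : phi al be p0 - phi al be q0 = al ^+ 2 + be ^+ 2.
    by rewrite /phi /al /be /F /=; ring.
  rewrite lt_neqAle addr_ge0 ?sqr_ge0// andbT eq_sym paddr_eq0 ?sqr_ge0//.
  rewrite !sqrf_eq0; apply/negP => /andP[/eqP h1 /eqP h2]; apply: fpq.
  by apply: eqf; rewrite [F _ _]surjective_pairing -/al -/be h1 h2.
have near x : exists2 r, 0 < r & forall y, `|y - x| < r ->
    `|phi al be y - phi al be x| < (phi al be p0 - phi al be q0) / 2.
  have [r r0 H] := @phi_near al be x _ 1 erefl ltr01.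
  pose l := `|al * (df x).1 + be * (df x).2| + 1.
  have l0 : 0 < l by rewrite ltr_wpDl.
  exists (Num.min r ((phi al be p0 - phi al be q0) / 2 / l)).
    by rewrite lt_min r0 !divr_gt0.
  move=> y; rewrite lt_min => /andP[/H h1 h2].
  rewrite -[X in `|X|](subrK ((al * (df x).1 + be * (df x).2) * (y - x))).
  apply: le_lt_trans (ler_normD _ _) _.
  rewrite normrM; rewrite ltr_pdivlMr// in h2.
  by move: h1 h2; rewrite /l mul1r => h1 h2; lra.
have [r1 r10 H1] := near p0; have [r2 r20 H2] := near q0.
exists (Num.min r1 r2); first by rewrite lt_min r10.
move=> a b c d abcd hp hq ab cd.
have pos p q : a <= p <= b -> c <= q <= d -> 0 < phi al be p - phi al be q.
  move=> /hp + /hq; rewrite !lt_min => /andP[/H1 + _] /andP[_ /H2].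
  rewrite !ltr_norml => h1 h2; lra.
have neq p q : a <= p <= b -> c <= q <= d -> f p <> f q.
  by move=> hp' hq' h; have := pos _ _ hp' hq'; rewrite /phi h subrr ltxx.
apply: (@cell_half_plane al be) => // p q hp' hq'; first by
  rewrite GE ?pos//; exact: neq.
by apply/negP => /Xin[_ _ /(neq _ _ hp' hq')].
Qed.

(** The form [(al, be)] is [1] on [df s] and [-1] on [df t]. The first loop leaves the node along
    [df s] and returns along [df t], so near its ends the form exceeds its value at the node. The
    second loop leaves along [df t] and returns along [df s], so there the form stays below. *)
Let cell_corner p0 q0 : p0 \in [:: s; t] -> q0 \in [:: t; e] ->
  local p0 q0 (fun a b c d => a < b -> c < d -> cell_ok a b c d).
Proof.
move=> hp0 hq0; pose D := cross (df s) (df t).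
pose al := ((df t).2 + (df s).2) / D; pose be := - ((df t).1 + (df s).1) / D.
have k0 : 0 < 2^-1 :> R by lra.
have ls : 1 = al * (df s).1 + be * (df s).2.
  by move: corner; rewrite /al /be /D /cross => c0; field.
have ltt : -1 = al * (df t).1 + be * (df t).2.
  by move: corner; rewrite /al /be /D /cross => c0; field.
have f0 : f p0 = f q0.
  move: hp0 hq0; rewrite !inE => /orP[]/eqP-> /orP[]/eqP->;
    by rewrite ?fst_eq ?fte.
have [r1 r10 H1] : exists2 r, 0 < r & forall p, `|p - p0| < r -> s <= p <= t ->
    p <> p0 -> 0 < phi al be p - phi al be p0.
  move: hp0; rewrite !inE => /orP[]/eqP->.
    have [r r0 H] := phi_near ls k0; exists r => // p /H + /andP[sp _] /eqP ps.
    have sp' : s < p by rewrite lt_neqAle eq_sym ps.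
    by rewrite (gtr0_norm (_ : 0 < p - s)) ?subr_gt0// ler_norml; lra.
  have [r r0 H] := phi_near ltt k0; exists r => // p /H + /andP[_ pt] /eqP ps.
  have pt' : p < t by rewrite lt_neqAle ps.
  by rewrite (ltr0_norm (_ : p - t < 0)) ?subr_lt0// ler_norml; lra.
have [r2 r20 H2] : exists2 r, 0 < r & forall q, `|q - q0| < r -> t <= q <= e ->
    q <> q0 -> phi al be q - phi al be q0 < 0.
  move: hq0; rewrite !inE => /orP[]/eqP->.
    have [r r0 H] := phi_near ltt k0; exists r => // q /H + /andP[tq _] /eqP qt.
    have tq' : t < q by rewrite lt_neqAle eq_sym qt.
    by rewrite (gtr0_norm (_ : 0 < q - t)) ?subr_gt0// ler_norml; lra.
  rewrite dfse in ls.
  have [r r0 H] := phi_near ls k0; exists r => // q /H + /andP[_ qe] /eqP ps.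
  have qe' : q < e by rewrite lt_neqAle ps.
  by rewrite (ltr0_norm (_ : q - e < 0)) ?subr_lt0// ler_norml; lra.
exists (Num.min r1 r2); first by rewrite lt_min r10.
move=> a b c d [sa bt tc de] hp hq ab cd.
have pos p q : a <= p <= b -> c <= q <= d -> f p <> f q ->
    0 < phi al be p - phi al be q.
  move=> hp' hq' fpq; have e0 : phi al be p0 = phi al be q0 by rewrite /phi f0.
  have [rp1 rq2] : `|p - p0| < r1 /\ `|q - q0| < r2.
    by move: (hp _ hp') (hq _ hq'); rewrite !lt_min => /andP[-> _] /andP[_ ->].
  have spt : s <= p <= t by lra.
  have tqe : t <= q <= e by lra.
  have [pp0|/eqP/(H1 _ rp1 spt)] := eqVneq p p0;
    have [qq0|/eqP/(H2 _ rq2 tqe)] := eqVneq q q0.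
  - by case: fpq; rewrite pp0 qq0.
  - by rewrite pp0; lra.
  - by rewrite qq0; lra.
  - lra.
apply: (@cell_half_plane al be) => // p q hp' hq'.
  have [fpq|fpq] := pselect (f p = f q); last by rewrite GE//; exact: pos.
  rewrite /G fpq eqxx /=; lra.
apply/negP => pqX; have [/= h1 h2 h3 _] := Xin pqX.
have pp0 : p <> p0 by move: hp0 => /[swap] <-; rewrite !inE => /orP[]/eqP; lra.
have [rp1 rq2] : `|p - p0| < r1 /\ `|q - q0| < r2.
  by move: (hp _ hp') (hq _ hq'); rewrite !lt_min => /andP[-> _] /andP[_ ->].
have spt : s <= p <= t by lra.
have tqe : t <= q <= e by lra.
have qq0 : q <> q0 by move: hq0 => /[swap] <-; rewrite !inE => /orP[]/eqP; lra.
have := H1 _ rp1 spt pp0; have := H2 _ rq2 tqe qq0.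
rewrite {1 3}/phi h3 -/(phi al be q).
have -> : phi al be p0 = phi al be q0 by rewrite /phi f0.
lra.
Qed.

Let cell_crossing p0 q0 : (p0, q0) \in X ->
  local p0 q0 (fun a b c d => forall h, 0 < h -> tame fst h a b -> tame snd h c d ->
    cell_ok a b c d).
Proof.
move=> pqX; have [/= hp0 hq0 f0 D0] := Xin pqX.
set u := df p0 in D0; set v := df q0 in D0; pose D := cross u v.
pose x1 := v.2 / D; pose x2 := - v.1 / D; pose y1 := - u.2 / D; pose y2 := u.1 / D.
have k0 : 0 < 10^-1 :> R by lra.
have xu : 1 = x1 * u.1 + x2 * u.2.
  by move: D0; rewrite /x1 /x2 /D /cross => c0; field.
have xv : 0 = x1 * v.1 + x2 * v.2.
  by move: D0; rewrite /x1 /x2 /D /cross => c0; field.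
have yu : 0 = y1 * u.1 + y2 * u.2.
  by move: D0; rewrite /y1 /y2 /D /cross => c0; field.
have yv : 1 = y1 * v.1 + y2 * v.2.
  by move: D0; rewrite /y1 /y2 /D /cross => c0; field.
have [rA rA0 HA] := phi_near xu k0; have [rB rB0 HB] := phi_near xv k0.
have [rK rK0 HK] := phi_near yu k0; have [rL rL0 HL] := phi_near yv k0.
(* The forms [(x1, x2)] and [(y1, y2)] give the coordinates in the basis [u], [v]. [A], [C] and [B],
   [L] are the coordinates of the displacement from the crossing along the two loops; to first order
   [A] and [L] are the identity, [B] and [C] vanish. *)
pose A x := phi x1 x2 (x + p0) - phi x1 x2 p0.
pose B y := phi x1 x2 (y + q0) - phi x1 x2 q0.
pose C x := phi y1 y2 (x + p0) - phi y1 y2 p0.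
pose L y := phi y1 y2 (y + q0) - phi y1 y2 q0.
exists (Num.min (Num.min rA rK) (Num.min rB rL)).
  by rewrite !lt_min rA0 rK0 rB0.
move=> a b c d inr hp hq h h0 [/andP[ab ba] tab] [/andP[cd dc] tcd].
have stA : steep A C (a - p0) (b - p0).
  move=> x xab; have /hp : a <= x + p0 <= b.
    by move: xab; rewrite lerBlDr lerBrDr.
  rewrite !lt_min => /andP[/andP[/HA h1 /HK h2] _].
  by move: h1 h2; rewrite !addrK mul1r mul0r subr0.
have stL : steep L B (c - q0) (d - q0).
  move=> x xab; have /hq : c <= x + q0 <= d.
    by move: xab; rewrite lerBlDr lerBrDr.
  rewrite !lt_min => /andP[_ /andP[/HB h1 /HL h2]].
  by move: h1 h2; rewrite !addrK mul1r mul0r subr0.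
have phiE p q : (phi x1 x2 p - phi x1 x2 q = A (p - p0) - B (q - q0)) *
    (phi y1 y2 p - phi y1 y2 q = C (p - p0) - L (q - q0)).
  by split; rewrite /A /B /C /L !subrK /phi f0; ring.
have isolated p q : a <= p <= b -> c <= q <= d -> f p = f q -> p = p0 /\ q = q0.
  move=> hp' hq' fpq.
  have [e1 e2] := phiE p q; rewrite /phi fpq !subrr in e1 e2.
  have [||||/eqP + /eqP] := steep_inj stA stL (x := p - p0) (y := q - q0).
  - by rewrite !lerD2r.
  - by rewrite !lerD2r.
  - by apply/eqP; rewrite -subr_eq0 -e1.
  - by apply/eqP; rewrite -subr_eq0 -e2.
  by rewrite !subr_eq0 => /eqP-> /eqP->.
(* By [compat], a cell is either centred at the crossing in both directions or beyond it on one of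
   four sides; the latter cells are settled here. *)
have off : [\/ h <= a - p0, b - p0 <= - h, h <= c - q0 | d - q0 <= - h] ->
    cell_ok a b c d.
  move=> O; have [||al [be H]] := off_cell h0 O _ _ stA stL;
    [by rewrite addrAC lerD2r..|].
  have pos p q : a <= p <= b -> c <= q <= d ->
      0 < phi (al * x1 + be * y1) (al * x2 + be * y2) p
        - phi (al * x1 + be * y1) (al * x2 + be * y2) q.
    move=> hp' hq'; have := H (p - p0) (q - q0); rewrite !lerD2r.
    by have [<- <-] := phiE p q => /(_ hp' hq'); congr (0 < _); rewrite /phi; ring.
  have neq p q : a <= p <= b -> c <= q <= d -> f p <> f q.
    by move=> hp' hq' E; have := pos _ _ hp' hq'; rewrite /phi E subrr ltxx.
  apply: (cell_half_plane ab cd) => p q hp' hq'.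
    by rewrite GE; [exact: pos|exact: neq].
  by apply/negP => /Xin[_ _ /(neq _ _ hp' hq')].
have cI := tab _ pqX; have cJ := tcd _ pqX.
case: cI => [[aE bE]|[bp|pa]];
  [|by apply/off/Or42; rewrite lerBlDl|by apply/off/Or41; rewrite lerBrDl].
case: cJ => [[cE dE]|[dq|qc]];
  [|by apply/off/Or44; rewrite lerBlDl|by apply/off/Or43; rewrite lerBrDl].
have vertex p q : a <= p <= b -> c <= q <= d -> f p <> f q ->
    (cross (G p q) v / cross u v = A (p - p0) - B (q - q0)) *
    (cross u (G p q) / cross u v = C (p - p0) - L (q - q0)).
  move=> hp' hq' fpq; have [<- <-] := phiE p q.
  by split; rewrite -GE// /cross /x1 /x2 /y1 /y2 /D /cross; ring.
(* By [isolated], no other element of [X] falls into this cell. *)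
rewrite /cell_ok /K (bigD1_seq (p0, q0))//= big1_seq ?addr0; last first.
  move=> [p q] /andP[/= pq /Xin[/= _ _ fpq _]]; case: andP; last by rewrite mulr0.
  move=> [/andP[ap pb] /andP[cq qd]]; have [] := isolated _ _ _ _ fpq.
  - by rewrite ap ltW.
  - by rewrite cq ltW.
  - by move=> h1 h2; rewrite h1 h2 eqxx in pq.
have [Ia Ib] : a <= a <= b /\ a <= b <= b by rewrite !lexx ltW.
have [Jc Jd] : c <= c <= d /\ c <= d <= d by rewrite !lexx ltW.
have -> : [&& a <= p0 < b, c <= q0 & q0 < d]
  by rewrite aE bE cE dE !gerBl !ltrDl ltW h0.
rewrite mulr1 /sg /= -/u -/v.
have neq p q : a <= p <= b -> c <= q <= d -> p <> p0 -> f p <> f q.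
  by move=> hp' hq' h1 /(isolated _ _ hp' hq')[].
have [ap0 bp0] : a <> p0 /\ b <> p0
  by split=> /eqP; rewrite ?aE ?bE -subr_eq0 addrAC subrr add0r ?oppr_eq0 gt_eqF.
have e1 : a - p0 = - h by rewrite aE addrAC subrr sub0r.
have e2 : b - p0 = h by rewrite bE addrAC subrr add0r.
have e3 : c - q0 = - h by rewrite cE addrAC subrr sub0r.
have e4 : d - q0 = h by rewrite dE addrAC subrr add0r.
rewrite e1 e2 in stA; rewrite e3 e4 in stL.
apply: (turn_steep D0 h0 stA stL).
- by have := vertex _ _ Ia Jc (neq _ _ Ia Jc ap0); rewrite e1 e3 => -[].
- by have := vertex _ _ Ib Jc (neq _ _ Ib Jc bp0); rewrite e2 e3 => -[].
- by have := vertex _ _ Ib Jd (neq _ _ Ib Jd bp0); rewrite e2 e4 => -[].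
- by have := vertex _ _ Ia Jd (neq _ _ Ia Jd ap0); rewrite e1 e4 => -[].
Qed.

Let cells : \forall h \near (0 : R)^'+, forall a b c d,
  tame fst h a b -> tame snd h c d -> inrect a b c d -> cell_ok a b c d.
Proof.
have key p0 q0 : s <= p0 <= t -> t <= q0 <= e ->
  local p0 q0 (fun a b c d => forall h, 0 < h -> tame fst h a b -> tame snd h c d ->
    cell_ok a b c d).
  move=> p0st q0te; have [fpq|] := pselect (f p0 = f q0).
    have [/cell_crossing//|[p0c q0c]] := XP p0st q0te fpq.
    have [r r0 H] := cell_corner p0c q0c; exists r => // a b c d abcd hp hq h h0.
    by move=> [/andP[ab _] _] [/andP[cd _] _]; exact: H.
  move=> /cell_nonzero[r r0 H]; exists r => // a b c d abcd hp hq h h0.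
  by move=> [/andP[ab _] _] [/andP[cd _] _]; exact: H.
(* Compactness of the rectangle turns the local statements [key] into a single bound on [h]. *)
have /compact_near_coveringP cov : compact (`[s, t] `*` `[t, e]).
  by apply: compact_setX; exact: segment_compact.
pose P (h : R) (z : R * R) := 0 < h -> forall b d,
  tame fst h z.1 b -> tame snd h z.2 d -> inrect z.1 b z.2 d -> cell_ok z.1 b z.2 d.
have covP : \forall h \near (0 : R)^'+, `[s, t] `*` `[t, e] `<=` P h.
  apply: cov => -[p0 q0] [/=]; rewrite !in_itv /= => hp0 hq0.
  have [r r0 H] := key _ _ hp0 hq0.
  (* If [a] is within [r / 2] of [p0] and [h < r / 4], the whole interval up to [b <= a + 2 * h] is
     within [r]; likewise for [c], [d] and [q0]. *)
  exists (ball (p0, q0) (r / 2), [set h | 0 < h < r / 4]); first split=> /=.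
  - by apply: nbhsx_ballx; rewrite divr_gt0.
  - near=> h; apply/andP; split; near: h.
      exact: nbhs_right_gt.
    by apply: nbhs_right_lt; rewrite divr_gt0.
  - move=> [[a c] h] [/= [/= pa qc] /andP[h0 hr]] _ b d /= tab tcd abcd.
    move: pa qc; rewrite /ball /= !ltr_norml => pa qc.
    have [/andP[ab ba] _] := tab; have [/andP[cd dc] _] := tcd.
    by apply: (H _ _ _ _ abcd _ _ h h0 tab tcd) => x xI; rewrite ltr_norml; lra.
near=> h => a b c d tab tcd [sa bt tc de].
have ab : a < b by case: tab => /andP[].
have cd : c < d by case: tcd => /andP[].
have : (`[s, t] `*` `[t, e]) (a, c) by split => /=; rewrite in_itv /=; lra.
have h0 : 0 < h by near: h; exact: nbhs_right_gt.
by move=> H; apply: (near covP h _ (a, c) H h0 b d).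
Unshelve. all: by end_near. Qed.

Lemma loops_crossing_sum : s < t -> t < e ->
  \sum_(z <- X) (if 0 < cross (df z.1) (df z.2) then -1 else 1 : int) = 0.
Proof.
move=> st te.
have m1 : {in map fst X, forall m, s < m < t}.
  by move=> _ /mapP[z /Xin[? _ _ _] ->].
have m2 : {in map snd X, forall m, t < m < e}.
  by move=> _ /mapP[z /Xin[_ ? _ _] ->].
near (0 : R)^'+ => h.
have [l1 l1t c1] : exists2 l, last s l = t & chain (fun a b =>
    step h s t a b /\ {in map fst X, forall m, compat h m a b}) s l.
  by near: h; exact: marked_chain_near.
have [l2 l2e c2] : exists2 l, last t l = e & chain (fun a b =>
    step h t e a b /\ {in map snd X, forall m, compat h m a b}) t l.
  by near: h; exact: marked_chain_near.
have ok a b c d : tame fst h a b -> tame snd h c d -> inrect a b c d ->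
  cell_ok a b c d by move: a b c d; near: h; exact: cells.
(* [H] belongs to a side with constant second parameter, [V] to one with constant first
   parameter. *)
pose H a b c := hit (G a c) (G b c); pose V b c d := hit (G b c) (G b d).
have KE a b c d : K a b c d = (H a b c - H a b d) + (V b c d - V a c d).
  rewrite /K /turn /H /V (hitC (G a c) (G a d)) (hitC (G a d) (G b d)).
  by ring.
have : psum (fun a b => psum (fun c d => K a b c d) t l2) s l1 = 0.
  (* [G] depends only on the values of [f]. So the [H] terms telescope to a difference that vanishes
     by [f t = f e], and the [V] terms to [W t - W s], zero by [f s = f t]. *)
  pose W b := psum (V b) t l2.
  transitivity (psum (fun a b => W b - W a) s l1).
    apply: (eq_psum c1) => a b _.
    rewrite (eq_psum c2 (g' := fun c d =>
        (- H a b d - - H a b c) + (V b c d - V a c d))).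
      rewrite psumD (psum_telescope (fun c => - H a b c)) psumB l2e.
      by rewrite /H /G /F fte subrr add0r.
    by move=> c d _; rewrite KE; ring.
  by rewrite psum_telescope l1t /W /V /G /F fst_eq subrr.
move=> K0; rewrite -[RHS]K0.
have ind (x y m : R) l (P : R -> R -> Prop) : x < m < y ->
  chain (fun a b => step h x y a b /\ P a b) x l -> last x l = y ->
  psum (fun a b : R => (a <= m < b)%R%:R) x l = 1.
  move=> /andP[xm my] cl ly.
  rewrite (eq_psum cl (g' := fun a b : R => (m < b)%R%:R - (m < a)%R%:R)).
    by rewrite (psum_telescope (fun a : R => (m < a)%R%:R)) ly my ltNge (ltW xm).
  move=> a b [[/andP[ab _] _ _] _]; case: (leP a m) => am /=; first by rewrite subr0.
  by rewrite (lt_trans am ab) subrr.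
transitivity (psum (fun a b => psum (fun c d => \sum_(z <- X)
    sg z * ((a <= z.1 < b) && (c <= z.2 < d))%:R) t l2) s l1); last first.
  apply: (eq_psum c1) => a b [[ab sa bt] cab].
  apply: (eq_psum c2) => c d [[cd tc de] ccd].
  apply/esym/ok => //; split=> // z zX; [apply: cab|apply: ccd]; exact: map_f.
transitivity (\sum_(z <- X) psum (fun a b => psum (fun c d =>
    sg z * ((a <= z.1 < b) && (c <= z.2 < d))%:R) t l2) s l1); last first.
  by rewrite -psum_sum; apply: (eq_psum c1) => a b _; rewrite -psum_sum.
apply: eq_big_seq => z zX.
transitivity (psum (fun a b => psum (fun c d =>
    sg z * (a <= z.1 < b)%R%:R * (c <= z.2 < d)%R%:R) t l2) s l1); last first.
  apply: (eq_psum c1) => a b _; apply: (eq_psum c2) => c d _.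
  by rewrite -mulrA -natrM mulnb.
rewrite (eq_psum c1 (g' := fun a b => sg z * (a <= z.1 < b)%R%:R)); last first.
  by move=> a b _; rewrite psumZ (ind _ _ _ _ _ _ c2) ?mulr1//; have [] := Xin zX.
by rewrite psumZ (ind _ _ _ _ _ _ c1) ?mulr1//; have [] := Xin zX.
Unshelve. all: by end_near. Qed.

End Loops.

(** * Curves on the sphere *)

Definition i0 : 'I_3 := Ordinal (isT : (0 < 3)%N).
Definition i1 : 'I_3 := Ordinal (isT : (1 < 3)%N).
Definition i2 : 'I_3 := Ordinal (isT : (2 < 3)%N).

Lemma sum_I3 (V : nmodType) (F : 'I_3 -> V) : \sum_i F i = F i0 + F i1 + F i2.
Proof.
rewrite !big_ord_recr big_ord0 /= add0r.
by congr (F _ + F _ + F _); exact: val_inj.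
Qed.

Lemma I3P (i : 'I_3) : [\/ i = i0, i = i1 | i = i2].
Proof.
by case: i => -[|[|[|//]]] h; [apply: Or31|apply: Or32|apply: Or33]; exact: val_inj.
Qed.

Lemma row3_eq (R : Type) (p q : 'rV[R]_3) :
  p 0 i0 = q 0 i0 -> p 0 i1 = q 0 i1 -> p 0 i2 = q 0 i2 -> p = q.
Proof. by move=> *; apply/rowP => i; case: (I3P i) => ->. Qed.

(** * Stereographic projection and its effect on orientation *)

Section Stereographic.
Variables (R : realType) (n : 'rV[R]_3).
Hypothesis nn : \sum_i n 0 i ^+ 2 = 1.
Hypothesis n2 : 0 < n 0 i2.
Implicit Types p v w : 'rV[R]_3.

Let a := n 0 i0.
Let b := n 0 i1.
Let c := n 0 i2.

Let unitE p : \sum_i p 0 i ^+ 2 = 1 -> p 0 i2 ^+ 2 = 1 - p 0 i0 ^+ 2 - p 0 i1 ^+ 2.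
Proof. by move=> <-; rewrite sum_I3; ring. Qed.

Let nnE : c ^+ 2 = 1 - a ^+ 2 - b ^+ 2 := unitE nn.

(* Stereographic projection from [n] to the plane orthogonal to [n]; points of
   this plane are given by their scalar products with its vectors
   (n_2, 0, - n_0) and (0, n_2, - n_1). *)
Definition height p : R := 1 - (n 0 i0 * p 0 i0 + n 0 i1 * p 0 i1 + n 0 i2 * p 0 i2).

Definition stereo p : R * R :=
  ((n 0 i2 * p 0 i0 - n 0 i0 * p 0 i2) / height p,
   (n 0 i2 * p 0 i1 - n 0 i1 * p 0 i2) / height p).

Definition dstereo p v : R * R :=
  let nv := n 0 i0 * v 0 i0 + n 0 i1 * v 0 i1 + n 0 i2 * v 0 i2 in
  ((n 0 i2 * v 0 i0 - n 0 i0 * v 0 i2) / height p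
     + (stereo p).1 * nv / height p,
   (n 0 i2 * v 0 i1 - n 0 i1 * v 0 i2) / height p
     + (stereo p).2 * nv / height p).

(** On the unit sphere, twice the height is the squared distance to [n]. *)
Lemma height_gt0 p : \sum_i p 0 i ^+ 2 = 1 -> p != n -> 0 < height p.
Proof.
move=> /unitE pp pn; have h2 : 2 * height p =
    (p 0 i0 - a) ^+ 2 + (p 0 i1 - b) ^+ 2 + (p 0 i2 - c) ^+ 2.
  by rewrite /height -/a -/b -/c; ring: pp nnE.
suff : 0 < 2 * height p by rewrite pmulr_rgt0.
rewrite h2 lt_neqAle !addr_ge0 ?sqr_ge0// andbT eq_sym.
apply: contraNneq pn => /eqP; rewrite !paddr_eq0 ?addr_ge0 ?sqr_ge0//.
rewrite !sqrf_eq0 !subr_eq0 => /andP[/andP[/eqP h_0 /eqP h_1] /eqP h_2].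
by apply/eqP/row3_eq.
Qed.

(** [(d0, d1, d2)] is [(p - n) / height p], the direction of the line from [n] to [p], computed from
    [stereo p] alone. Its length then determines [height p], hence [p]. *)
Let inverse p : \sum_i p 0 i ^+ 2 = 1 -> p != n ->
  let d2 := - c - a * (stereo p).1 - b * (stereo p).2 in
  let d0 := ((stereo p).1 + a * d2) / c in
  let d1 := ((stereo p).2 + b * d2) / c in
  [/\ height p * (d0 ^+ 2 + d1 ^+ 2 + d2 ^+ 2) = 2,
      p 0 i0 = a + height p * d0, p 0 i1 = b + height p * d1
    & p 0 i2 = c + height p * d2].
Proof.
move=> pp pn d2 d0 d1; have h0 := height_gt0 pp pn.
have hE : height p = 1 - (a * p 0 i0 + b * p 0 i1 + c * p 0 i2) by [].
have hN0 : height p != 0 by rewrite gt_eqF.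
have c0 : c != 0 by rewrite gt_eqF.
have s1 : height p * (stereo p).1 = c * p 0 i0 - a * p 0 i2.
  by rewrite /stereo /= mulrC divfK.
have s2 : height p * (stereo p).2 = c * p 0 i1 - b * p 0 i2.
  by rewrite /stereo /= mulrC divfK.
have e2 : height p * d2 = p 0 i2 - c.
  transitivity (- height p * c - a * (height p * (stereo p).1)
                - b * (height p * (stereo p).2)); first by rewrite /d2; ring.
  by rewrite s1 s2 hE; ring: nnE.
have e0 : height p * d0 = p 0 i0 - a.
  apply: (mulfI c0); transitivity (height p * (stereo p).1 + a * (height p * d2)).
    by rewrite /d0; field.
  by rewrite s1 e2; ring.
have e1 : height p * d1 = p 0 i1 - b.
  apply: (mulfI c0); transitivity (height p * (stereo p).2 + b * (height p * d2)).
    by rewrite /d1; field.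
  by rewrite s2 e2; ring.
split; [|by rewrite e0 subrKC|by rewrite e1 subrKC|by rewrite e2 subrKC].
apply: (mulfI hN0); rewrite mulrA -expr2 2!mulrDr -!exprMn e0 e1 e2 hE.
by have {}pp := unitE pp; ring: pp nnE.
Qed.

Lemma stereo_inj (p q : 'rV[R]_3) : \sum_i p 0 i ^+ 2 = 1 -> \sum_i q 0 i ^+ 2 = 1 ->
  p != n -> q != n -> stereo p = stereo q -> p = q.
Proof.
move=> pp qq pn qn pq.
have [hp p0 p1 p2] := inverse pp pn; have [hq q0 q1 q2] := inverse qq qn.
have hpq : height p = height q.
  move: hp hq; rewrite pq; set D := (X in _ * X) => hp hq.
  have D0 : D != 0.
    apply/eqP => D0; move: hp; rewrite D0 mulr0 => /eqP.
    by rewrite eq_sym (pnatr_eq0 _ 2).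
  by apply: (mulIf D0); rewrite hp hq.
move: p0 p1 p2; rewrite pq hpq -q0 -q1 -q2 => p0 p1 p2.
exact: row3_eq.
Qed.

Definition dot v w : R := v 0 i0 * w 0 i0 + v 0 i1 * w 0 i1 + v 0 i2 * w 0 i2.

Lemma areaE p v w : area p v w =
  p 0 i0 * (v 0 i1 * w 0 i2 - v 0 i2 * w 0 i1) +
  p 0 i1 * (v 0 i2 * w 0 i0 - v 0 i0 * w 0 i2) +
  p 0 i2 * (v 0 i0 * w 0 i1 - v 0 i1 * w 0 i0).
Proof.
rewrite /area (expand_det_row _ i0) sum_I3 /cofactor.
have det2 (A : 'M[R]_2) : \det A = A 0 0 * A 1 1 - A 0 1 * A 1 0.
  rewrite (expand_det_row _ 0) !big_ord_recr big_ord0 /= add0r /cofactor.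
  rewrite !det_mx11 !mxE /= expr0 expr1 mul1r mulN1r mulrN.
  by congr (A _ _ * A _ _ - A _ _ * A _ _); exact: val_inj.
have [l00 l01] : lift i0 (0 : 'I_2) = i1 /\ lift i0 (1 : 'I_2) = i2.
  by split; exact: val_inj.
have [l10 l11] : lift i1 (0 : 'I_2) = i0 /\ lift i1 (1 : 'I_2) = i2.
  by split; exact: val_inj.
have [l20 l21] : lift i2 (0 : 'I_2) = i0 /\ lift i2 (1 : 'I_2) = i1.
  by split; exact: val_inj.
by rewrite !det2 !mxE /= l00 l01 l10 l11 l20 l21; ring.
Qed.

Lemma area_anti p v w : area p w v = - area p v w.
Proof. by rewrite !areaE; ring. Qed.

(** The left-hand sides are the entries of the vector product of [v] and [w], which is normal to the
    sphere when both are tangent. *)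
Lemma cross_minors p v w : \sum_i p 0 i ^+ 2 = 1 -> dot p v = 0 -> dot p w = 0 ->
  [/\ v 0 i1 * w 0 i2 - v 0 i2 * w 0 i1 = area p v w * p 0 i0,
      v 0 i2 * w 0 i0 - v 0 i0 * w 0 i2 = area p v w * p 0 i1
    & v 0 i0 * w 0 i1 - v 0 i1 * w 0 i0 = area p v w * p 0 i2].
Proof.
rewrite /dot sum_I3 areaE => pp pv pw.
have h (k l x y : R) : x * (p 0 i0 ^+ 2 + p 0 i1 ^+ 2 + p 0 i2 ^+ 2) =
    y + k * (p 0 i0 * v 0 i0 + p 0 i1 * v 0 i1 + p 0 i2 * v 0 i2)
      + l * (p 0 i0 * w 0 i0 + p 0 i1 * w 0 i1 + p 0 i2 * w 0 i2) -> x = y.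
  by rewrite pp pv pw mulr1 !mulr0 !addr0.
split.
- by apply: (h (p 0 i1 * w 0 i2 - p 0 i2 * w 0 i1)
    (p 0 i2 * v 0 i1 - p 0 i1 * v 0 i2)); ring.
- by apply: (h (p 0 i2 * w 0 i0 - p 0 i0 * w 0 i2)
    (p 0 i0 * v 0 i2 - p 0 i2 * v 0 i0)); ring.
- by apply: (h (p 0 i0 * w 0 i1 - p 0 i1 * w 0 i0)
    (p 0 i1 * v 0 i0 - p 0 i0 * v 0 i1)); ring.
Qed.

(** [dstereo] is the differential of [stereo]. Since [0 < c], the factor is negative everywhere, so
    the projection reverses all crossing signs together. *)
Lemma cross_dstereo p v w : \sum_i p 0 i ^+ 2 = 1 -> p != n ->
  dot p v = 0 -> dot p w = 0 ->
  cross (dstereo p v) (dstereo p w) = - (c / height p ^+ 2) * area p v w.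
Proof.
move=> pp pn pv pw; have [m0 m1 m2] := cross_minors pp pv pw.
have hN0 : height p != 0 by rewrite gt_eqF // height_gt0.
move/unitE in pp; move: (area p v w) m0 m1 m2 => A m0 m1 m2.
have hE : height p = 1 - (a * p 0 i0 + b * p 0 i1 + c * p 0 i2) by [].
pose e1 (u : 'rV[R]_3) := c * u 0 i0 - a * u 0 i2.
pose e2 (u : 'rV[R]_3) := c * u 0 i1 - b * u 0 i2.
have key : (e1 v * height p + e1 p * dot n v) * (e2 w * height p + e2 p * dot n w) -
    (e2 v * height p + e2 p * dot n v) * (e1 w * height p + e1 p * dot n w) =
    - c * height p ^+ 2 * A.
  (* The products are regrouped into the minors of [v] and [w], to which [m0], [m1] and [m2]
     apply. *)
  transitivity (c * height p ^+ 2 * (a * (v 0 i1 * w 0 i2 - v 0 i2 * w 0 i1) +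
     b * (v 0 i2 * w 0 i0 - v 0 i0 * w 0 i2) +
     c * (v 0 i0 * w 0 i1 - v 0 i1 * w 0 i0))
   + height p * ((v 0 i1 * w 0 i2 - v 0 i2 * w 0 i1) *
         (a * b * e2 p - (b ^+ 2 + c ^+ 2) * e1 p)
     + (v 0 i2 * w 0 i0 - v 0 i0 * w 0 i2) *
         (a * b * e1 p - (a ^+ 2 + c ^+ 2) * e2 p)
     + (v 0 i0 * w 0 i1 - v 0 i1 * w 0 i0) * (b * c * e2 p + a * c * e1 p))).
    by rewrite /e1 /e2 /dot -/a -/b -/c; ring.
  by rewrite m0 m1 m2 hE /e1 /e2; ring: pp nnE.
transitivity (((e1 v * height p + e1 p * dot n v) *
     (e2 w * height p + e2 p * dot n w) -
    (e2 v * height p + e2 p * dot n v) * (e1 w * height p + e1 p * dot n w))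
      / height p ^+ 4).
  by rewrite /cross /dstereo /stereo /= -/(dot n v) -/(dot n w) -/a -/b -/c /e1 /e2;
    field.
by rewrite key; field.
Qed.

End Stereographic.

(** * Generic curves: a missed point, and the crossings between two loops *)

Section Curve.
Variables (R : realType) (gamma : R -> 'rV[R]_3).
Hypothesis gen : pointed_generic_curve gamma.

Lemma is_derive_coord t i :
  is_derive t (1 : R) (fun x => gamma x 0 i) (velocity gamma t 0 i).
Proof.
have dg : derivable gamma t 1 := @curve_smooth _ _ gen 0 t.
split; first exact: (derivable_mxP gamma t 1).1.
by rewrite /velocity derive1E derive_mx// mxE.
Qed.

Lemma derivable_velocity_coord t i : derivable (fun x => velocity gamma x 0 i) t 1.
Proof.
by have dg := @curve_smooth _ _ gen 1 t; exact: (derivable_mxP _ t 1).1 dg _ _.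
Qed.

Lemma curve_addn t (k : nat) : gamma (t + k%:R) = gamma t.
Proof.
elim: k => [|k IH]; first by rewrite addr0.
by rewrite -natr1 addrA (curve_closed gen) IH.
Qed.

Lemma curve_mod1 t : exists2 u, 0 <= u < 1 & gamma u = gamma t.
Proof.
exists (t - (Num.floor t)%:~R).
  have /andP[h1 h2] := real_floor_itv (num_real t).
  by rewrite subr_ge0 h1 ltrBlDl -[X in _ + X]mulr1z -intrD.
case: (Num.floor t) => k.
  by rewrite -{2}(subrK (k%:R) t) curve_addn.
by rewrite NegzE mulrNz opprK curve_addn.
Qed.

Lemma velocity_add1 t : velocity gamma (t + 1) = velocity gamma t.
Proof.
rewrite /velocity /derive1.
under eq_fun do rewrite addrA !(curve_closed gen).
by [].
Qed.

Lemma dot_velocity t : dot (gamma t) (velocity gamma t) = 0.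
Proof.
pose g x := gamma x 0 i0 * gamma x 0 i0 + gamma x 0 i1 * gamma x 0 i1
            + gamma x 0 i2 * gamma x 0 i2.
have gE : g = cst 1.
  apply/funext => x; rewrite /g -!expr2 -(sum_I3 (fun i => gamma x 0 i ^+ 2)).
  exact: curve_sphere.
have dg i := is_deriveM (is_derive_coord t i) (is_derive_coord t i).
have := is_deriveD (is_deriveD (dg i0) (dg i1)) (dg i2).
rewrite -[_ + _ + _]/(g) gE => -[_].
rewrite derive_cst => /eqP; rewrite eq_sym /dot -!mulr2n -!mulrnDl mulrn_eq0 /=.
by move=> /eqP.
Qed.

Lemma lipschitz_coord i : exists2 L, 0 <= L &
  {in `[0, 1]%R &, forall x y, `|gamma x 0 i - gamma y 0 i| <= L * `|x - y|}.
Proof.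
pose v x := `|velocity gamma x 0 i|.
have cv : {within `[(0 : R), 1], continuous v}.
  apply: continuous_subspaceT => x.
  apply: continuous_comp; last exact: norm_continuous.
  exact/differentiable_continuous/derivable1_diffP/derivable_velocity_coord.
have [c _ vc] := EVT_max ler01 cv.
exists (v c) => [|x y x01 y01]; first exact: normr_ge0.
wlog xy : x y x01 y01 / x < y => [H|].
  have [xy|yx|->] := ltgtP x y; [exact: H| |by rewrite !subrr !normr0 mulr0].
  by rewrite distrC (distrC x); exact: H.
have [| |z zxy E] := @MVT _ (fun x => gamma x 0 i)
  (fun x => velocity gamma x 0 i) x y xy.
- by move=> z _; exact: is_derive_coord.
- apply: derivable_within_continuous => z _.
  by have [] := is_derive_coord z i.
rewrite distrC E normrM distrC ler_wpM2r//; apply: vc.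
by move: zxy x01 y01; rewrite !in_itv /=; lra.
Qed.

(* The curve is Lipschitz on [0, 1], so for large [M] it cannot pass through all
   of [M ^ 2] points at mutual distance at least [1 / (2 M)]. *)
Lemma missing_point : exists n : 'rV[R]_3,
  [/\ \sum_i n 0 i ^+ 2 = 1, 0 < n 0 i2 & forall t, gamma t != n].
Proof.
have [L0 L00 lip0] := lipschitz_coord i0; have [L1 L10 lip1] := lipschitz_coord i1.
pose M := (Num.truncn (2 * (L0 + L1))).+2.
have ML : 2 * (L0 + L1) + 1 <= M%:R :> R.
  have := truncnS_gt (2 * (L0 + L1)); rewrite /M -[_.+2]addn1 natrD; lra.
(* A grid of mesh [1 / (2 * M)] in [[0, 1 / 2[], small enough for the third coordinate of [n k l] to
   be the root of a positive number. *)
pose x (k : 'I_M) : R := k%:R / (2 * M%:R).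
have M0 : 0 < M%:R :> R by rewrite ltr0n.
have x12 k : 0 <= x k < 2^-1.
  rewrite divr_ge0 ?ler0n ?mulr_ge0 ?ler0n//= ltr_pdivrMr ?mulr_gt0//.
  by rewrite mulrA mulVf ?mul1r ?ltr_nat// pnatr_eq0.
pose z k l : R := 1 - x k ^+ 2 - x l ^+ 2.
have z0 k l : 0 < z k l.
  have := x12 k; have := x12 l; rewrite /z; set u := x k; set v := x l.
  move=> /andP[u0 u1] /andP[v0 v1].
  have : u ^+ 2 < 2^-1 ^+ 2 by rewrite ltr_pXn2r// ?nnegrE ?invr_ge0.
  have : v ^+ 2 < 2^-1 ^+ 2 by rewrite ltr_pXn2r// ?nnegrE ?invr_ge0.
  lra.
pose n k l : 'rV[R]_3 := \row_i nth 0 [:: x k; x l; Num.sqrt (z k l)] i.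
suff [[k l] H] : exists kl : 'I_M * 'I_M,
    forall t, 0 <= t < 1 -> gamma t <> n kl.1 kl.2.
  exists (n k l); split.
  - by rewrite sum_I3 !mxE /= sqr_sqrtr ?ltW// /z; ring.
  - by rewrite mxE /= sqrtr_gt0.
  - by move=> t; have [u u01 <-] := curve_mod1 t; apply/eqP; exact: H.
apply: contrapT => /forallNP H.
have {H}/choice[t tP] : forall kl : 'I_M * 'I_M,
    exists t, 0 <= t < 1 /\ gamma t = n kl.1 kl.2.
  by move=> kl; have /existsNP[t /not_implyP[t01 /contrapT tE]] := H kl; exists t.
(* Two of the [M ^ 2] parameters fall into the same of [N] intervals, so they differ by at most
   [1 / N]. With the Lipschitz bound this gives [N <= 2 * M * L <= M * (M - 1) < N]. *)
pose N := (M * M).-1.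
have NE : N%:R = M%:R * M%:R - 1 :> R by rewrite /N -subn1 natrB ?muln_gt0// natrM.
have M2 : 2 <= M%:R :> R by rewrite ler_nat.
have N0 : 0 < N%:R :> R by rewrite NE; nra.
have qN kl : (Num.truncn (N%:R * t kl) < N)%N.
  have [/andP[t0 t1] _] := tP kl; rewrite -(ltr_nat R).
  have /andP[qt _] := truncn_itv (mulr_ge0 (ltW N0) t0).
  by apply: le_lt_trans qt _; rewrite gtr_pMr.
have : ~~ injectiveb (fun kl => Ordinal (qN kl)).
  apply/negP => /injectiveP/leq_card; rewrite card_prod !card_ord /N.
  by rewrite -ltnS prednK ?muln_gt0// ltnn.
move=> /injectivePn[kl [kl' neq] /(congr1 val) /= Eq].
have [/andP[t0 t1] gE] := tP kl; have [/andP[t0' t1'] gE'] := tP kl'.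
have tt' : N%:R * `|t kl - t kl'| <= 1.
  have := truncn_itv (mulr_ge0 (ltW N0) t0).
  have := truncn_itv (mulr_ge0 (ltW N0) t0').
  have -> : N%:R * `|t kl - t kl'| = `|N%:R * t kl - N%:R * t kl'|.
    by rewrite -mulrBr normrM (gtr0_norm N0).
  by rewrite Eq -natr1 ler_norml; lra.
have far (k k' : 'I_M) : k != k' -> 1 <= 2 * M%:R * `|x k - x k'|.
  move=> kk'; have -> : x k - x k' = (k%:R - k'%:R) / (2 * M%:R).
    by rewrite /x mulrBl.
  rewrite normrM normfV (gtr0_norm (_ : 0 < 2 * M%:R)) ?mulr_gt0//.
  rewrite mulrCA mulfV ?mulr1 ?mulf_neq0 ?gt_eqF//.
  have [kk|kk|/val_inj kk] := ltngtP k k'; last by rewrite kk eqxx in kk'.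
    by rewrite distrC -natrB ?(ltnW kk)// ger0_norm// ler1n subn_gt0.
  by rewrite -natrB ?(ltnW kk)// ger0_norm// ler1n subn_gt0.
have absurd (L : R) k k' : 0 <= L -> L <= L0 + L1 -> k != k' ->
    `|x k - x k'| <= L * `|t kl - t kl'| -> False.
  move=> L0' LL /far h1 h2.
  have h3 : 1 <= 2 * M%:R * L * `|t kl - t kl'|.
    by apply: le_trans h1 _; rewrite -[leRHS]mulrA ler_wpM2l// mulr_ge0// ltW.
  have h4 : N%:R <= 2 * M%:R * L.
    rewrite -[leLHS]mulr1; apply: le_trans (ler_wpM2l (ltW N0) h3) _.
    by rewrite mulrCA ler_piMr// !mulr_ge0// ltW.
  have : 2 * M%:R * L <= M%:R * (M%:R - 1).
    by rewrite mulrAC mulrC (ler_wpM2l (ltW M0))//; lra.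
  by move: h4; rewrite NE mulrBr mulr1; lra.
have u01 (u : R) : 0 <= u -> u < 1 -> u \in `[0, 1]%R :> bool by rewrite in_itv /=; lra.
have := neq; rewrite -pair_eqE negb_and => /orP[kk|kk].
  apply: (absurd L0 _ _ L00 _ kk); first by lra.
  by have := lip0 _ _ (u01 _ t0 t1) (u01 _ t0' t1'); rewrite gE gE' !mxE.
apply: (absurd L1 _ _ L10 _ kk); first by lra.
by have := lip1 _ _ (u01 _ t0 t1) (u01 _ t0' t1'); rewrite gE gE' !mxE.
Qed.

(** If the area vanished, [cross_minors] would give [w_i v = v_i w] for each [i]. By transversality
    all [v_i] would be zero, against immersion. *)
Lemma area_neq0 p q : 0 <= p < 1 -> 0 <= q < 1 -> p != q -> gamma p = gamma q ->
  area (gamma p) (velocity gamma p) (velocity gamma q) != 0.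
Proof.
move=> p01 q01 pq gpq; have dpq : double gamma p q by split.
have := curve_transverse gen dpq.
set v := velocity gamma p; set w := velocity gamma q.
apply: contraTneq => A0; apply/negP => /row_free_inj inj.
have [] := cross_minors (curve_sphere gen p) (dot_velocity p)
  (_ : dot (gamma p) w = 0).
  by rewrite gpq dot_velocity.
rewrite A0 !mul0r => /subr0_eq m0 /subr0_eq m1 /subr0_eq m2.
have /negP[] := curve_immersed gen p.
suff vi i : v 0 i = 0 by apply/eqP/rowP => i; rewrite mxE; exact: vi.
pose u : 'rV[R]_(1 + 1) := row_mx (w 0 i)%:M (- v 0 i)%:M.
have /inj/(congr1 (fun m : 'rV[R]_(1 + 1) => m 0 (rshift 1 0))) :
    u *m col_mx v w = 0 *m col_mx v w.
  rewrite mul0mx mul_row_col !mul_scalar_mx; apply/rowP => j; rewrite !mxE.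
  rewrite -/v in m0 m1 m2; apply/eqP; rewrite mulNr subr_eq0; apply/eqP.
  clear u; rewrite mulrC.
  have [->|->|->] := I3P i; have [->|->|->] := I3P j => //;
    first [exact: mulrC | by rewrite mulrC].
by rewrite row_mxEr !mxE /= mulr1n => /eqP; rewrite oppr_eq0 => /eqP.
Qed.

(** The loops [[s, t]] and [[t, s + 1]] are projected from a missed point to the plane, where
    [loops_crossing_sum] applies. *)
Lemma sphere_crossing_sum s t (X : seq (R * R)) : 0 <= s -> s < t -> t < 1 ->
  gamma s = gamma t ->
  (forall z, z \in X ->
     [/\ s < z.1 < t, t < z.2 < s + 1 & gamma z.1 = gamma z.2]) ->
  (forall p q, s < p < t -> t < q < s + 1 -> gamma p = gamma q -> (p, q) \in X) ->
  uniq X ->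
  \sum_(z <- X) (if 0 < area (gamma z.1) (velocity gamma z.1) (velocity gamma z.2)
                 then -1 else 1 : int) = 0.
Proof.
move=> s0 st t1 gst Xin XP Xu.
have [n [nn n2 gn]] := missing_point.
pose f x := stereo n (gamma x); pose df x := dstereo n (gamma x) (velocity gamma x).
have f_inj p q : f p = f q -> gamma p = gamma q.
  by apply: stereo_inj => //; exact: curve_sphere.
have hdf p : height n (gamma p) != 0.
  by rewrite gt_eqF// height_gt0//; exact: curve_sphere.
have is_derive_stereo x :
    is_derive x (1 : R) (fun y => (f y).1) (df x).1 /\
    is_derive x (1 : R) (fun y => (f y).2) (df x).2.
  pose H y := height n (gamma y).
  have dg i k : is_derive x (1 : R) (fun y => k * gamma y 0 i) (k * velocity gamma x 0 i).
    exact: (is_deriveZ k (is_derive_coord x i)).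
  have dH : is_derive x (1 : R) H (- dot n (velocity gamma x)).
    have := is_deriveB (is_derive_cst (1 : R) x 1)
      (is_deriveD (is_deriveD (dg i0 (n 0 i0)) (dg i1 (n 0 i1))) (dg i2 (n 0 i2))).
    by rewrite sub0r.
  have dV : is_derive x (1 : R) (fun y => (H y)^-1)
      ((H x) ^- 2 * dot n (velocity gamma x)).
    split; first by apply: derivableV; [exact: hdf|case: dH].
    rewrite deriveV; [|exact: hdf|by case: dH].
    have [_ ->] := dH; rewrite -[_ *: _]/(_ * _); ring.
  have dN i : is_derive x (1 : R) (fun y => n 0 i2 * gamma y 0 i - n 0 i * gamma y 0 i2)
      (n 0 i2 * velocity gamma x 0 i - n 0 i * velocity gamma x 0 i2).
    exact: (is_deriveB (dg i _) (dg i2 _)).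
  have hx := hdf x.
  have D i : is_derive x (1 : R)
      (fun y => (n 0 i2 * gamma y 0 i - n 0 i * gamma y 0 i2) / H y) _ :=
    is_deriveM (dN i) dV.
  split; [apply: eq_ind (D i0) _ _|apply: eq_ind (D i1) _ _];
    by rewrite -![_ *: _]/(_ * _) /df /dstereo /stereo /H /dot /=; field.
have cross_df p q : gamma p = gamma q -> cross (df p) (df q) =
    - (n 0 i2 / height n (gamma p) ^+ 2) *
      area (gamma p) (velocity gamma p) (velocity gamma q).
  move=> gpq; rewrite /df -gpq (cross_dstereo nn)//.
  - exact: curve_sphere.
  - exact: dot_velocity.
  - by rewrite gpq dot_velocity.
have k0 p : 0 < n 0 i2 / height n (gamma p) ^+ 2.
  by rewrite divr_gt0// exprn_even_gt0//=.
have gs1 : gamma (s + 1) = gamma s by exact: curve_closed.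
have wrap q : t < q < s + 1 -> exists q',
    [/\ 0 <= q' < 1, gamma q' = gamma q, velocity gamma q' = velocity gamma q
      & q' < s \/ t < q'].
  move=> tq; have [q1|q1] := ltP q 1; first by exists q; split=> //; [lra|right; lra].
  exists (q - 1); split; [lra| | |left; lra].
  - by rewrite -(curve_closed gen) subrK.
  - by rewrite -velocity_add1 subrK.
have dst : double gamma s t by split=> //; [lra|lra|rewrite lt_eqF].
have dts : double gamma t s by split=> //; [lra|lra|rewrite gt_eqF].
have areaX z : z \in X ->
    area (gamma z.1) (velocity gamma z.1) (velocity gamma z.2) != 0.
  case/Xin => zst /wrap[q [q01 gq vq qst]] gz.
  rewrite -vq; apply: area_neq0 => //; [lra| |by rewrite gz].
  by apply/eqP => zq; move: qst; rewrite -zq; lra.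
have dst0 : double gamma s s -> False by case; rewrite eqxx.
(* As the node is only a double point, the second loop meets it at its ends alone. *)
have edge q : t <= q <= s + 1 -> gamma q = gamma s -> q \in [:: t; s + 1].
  move=> tq gq; rewrite !inE; have [//|qt] := eqVneq q t.
  have [//|qs] := eqVneq q (s + 1).
  have [|q' [q'01 gq' _ q's]] := wrap q.
    by rewrite !lt_neqAle eq_sym qt qs.
  have dsq : double gamma s q'.
    split=> //; [lra| |by rewrite gq' gq].
    by apply/eqP => sq'; move: q's; rewrite -sq'; lra.
  by have := curve_double gen dst dsq; lra.
have E : \sum_(z <- X) (if 0 < cross (df z.1) (df z.2) then -1 else 1 : int) = 0.
  apply: (@loops_crossing_sum R f df s t (s + 1) X) => //.
  - move=> x; exact: (is_derive_stereo x).1.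
  - move=> x; exact: (is_derive_stereo x).2.
  - by rewrite /f gst.
  - by rewrite /f gs1 gst.
  - by rewrite /df gs1 velocity_add1.
  - rewrite cross_df//; apply: mulf_neq0; first by rewrite oppr_eq0 gt_eqF.
    by apply: area_neq0 => //; [lra|lra|rewrite lt_eqF].
  - move=> p q stp tqe /f_inj gpq.
    have [ps|ps] := eqVneq p s.
      by right; rewrite ps mem_head edge// -gpq ps.
    have [pt|pt] := eqVneq p t.
      by right; rewrite pt mem_seq2 eqxx orbT edge// -gpq pt.
    have dsp : gamma p = gamma s -> False.
      move=> gps; have : double gamma s p by split=> //; [lra|lra|rewrite eq_sym].
      by move=> /(curve_double gen dst) tp; rewrite tp eqxx in pt.
    left; apply: XP => //.
      by rewrite !lt_neqAle eq_sym ps pt.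
    rewrite !lt_neqAle; case/andP: tqe => -> ->; rewrite !andbT; apply/andP.
    by split; apply/eqP => qE; apply: dsp; rewrite gpq -?qE// qE.
  - move=> z zX; have [h1 h2 h3] := Xin _ zX; split=> //; first by rewrite /f h3.
    rewrite cross_df//; apply: mulf_neq0; first by rewrite oppr_eq0 gt_eqF.
    exact: areaX.
  - lra.
transitivity (- \sum_(z <- X) (if 0 < cross (df z.1) (df z.2) then -1 else 1 : int)).
  rewrite -sumrN; apply: eq_big_seq => z zX.
  have [_ _ /cross_df->] := Xin _ zX.
  have := areaX _ zX; move: (area _ _ _) => A A0.
  rewrite mulNr oppr_gt0 (pmulr_rlt0 _ (k0 _)).
  by have [A1|A1|A1] := ltgtP A 0; rewrite ?opprK//; rewrite A1 eqxx in A0.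
by rewrite E oppr0.
Qed.

End Curve.

Local Close Scope classical_set_scope.

(** * Linked letters of spherical words *)

Definition eps (w : signed_word) (a : nat) : int := if minus w a then -1 else 1.

Definition pat (w : signed_word) (a b : nat) : seq nat :=
  [seq x <- word w | (x == a) || (x == b)].

Definition inst (v : seq nat) (a b : nat) : seq nat :=
  [seq if i == 0%N then a else b | i <- v].

Definition occ (v : seq nat) (w : signed_word) (a b : nat) : int :=
  (pat w a b == inst v a b)%:R.

Lemma patC w a b : pat w b a = pat w a b.
Proof. by apply: eq_filter => k; rewrite orbC. Qed.

(** The number [n(a)]. For each [b] at most one of the two terms is nonzero, depending on which
    letter comes first. *)
Definition link (w : signed_word) (a : nat) : int :=
  \sum_(b <- undup (word w) | b != a) (occ ABAB w a b - occ ABAB w b a) * eps w b.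

Lemma gauss_count (w : signed_word) a : a \in word w -> count_mem a (word w) = 2%N.
Proof. by move/(allP (gauss_word w))/eqP. Qed.

Lemma split_twice (T : eqType) (a : T) (s : seq T) : count_mem a s = 2%N ->
  exists x y z, [/\ s = x ++ a :: y ++ a :: z, a \notin x, a \notin y & a \notin z].
Proof.
move=> c2; have as_ : a \in s by rewrite -has_pred1 has_count c2.
case/splitPr: as_ c2 => x y; rewrite count_cat /= eqxx => c2.
have [ax|ax] := boolP (a \in x).
  case/splitPr: ax c2 => x1 x2; rewrite count_cat /= eqxx => c2.
  exists x1, x2, y; rewrite -catA; split=> //; rewrite -has_pred1 has_count; lia.
have cx : count_mem a x = 0%N by apply/eqP; rewrite -leqn0 leqNgt -has_count has_pred1.
have ay : a \in y by rewrite -has_pred1 has_count; lia.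
case/splitPr: ay c2 => y1 y2; rewrite count_cat /= eqxx => c2.
by exists x, y1, y2; split=> //; rewrite -has_pred1 has_count; lia.
Qed.

Lemma big_undup_count (F : nat -> int) (s t : seq nat) : {subset s <= t} ->
  \sum_(y <- s) F y = \sum_(b <- undup t) (count_mem b s)%:R * F b.
Proof.
elim: s => [|y s IH] st; first by rewrite big_nil big1// => b _; rewrite mul0r.
rewrite big_cons IH => [|z zs]; last by apply: st; rewrite inE zs orbT.
have yt : y \in undup t by rewrite mem_undup st ?mem_head.
rewrite [in RHS](bigD1_seq y) ?undup_uniq//= (bigD1_seq y) ?undup_uniq//= eqxx.
rewrite natrD mulrDl mul1r addrA; congr (_ + _); apply: eq_bigr => b yb.
by rewrite (eq_sym y) (negbTE yb).
Qed.

Lemma big_count_mem (c : nat) (e : int) (s : seq nat) :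
  \sum_(v <- s) (if c == v then e else 0) = (count_mem c s)%:R * e.
Proof.
elim: s => [|v s IH]; first by rewrite big_nil mul0r.
rewrite big_cons IH /= natrD mulrDl eq_sym.
by case: eqP; rewrite ?mul1r ?mul0r.
Qed.

Lemma filter_two (a b : nat) s : a \notin s ->
  [seq k <- s | (k == a) || (k == b)] = nseq (count_mem b s) b.
Proof.
elim: s => //= k s IH; rewrite inE negb_or => /andP[ak /IH->].
by rewrite eq_sym (negbTE ak) /=; case: eqVneq => // ->.
Qed.

Lemma occ_ABAB_count (w : signed_word) a b x y z : b != a ->
  word w = x ++ a :: y ++ a :: z -> a \notin x -> a \notin y -> a \notin z ->
  b \in word w ->
  occ ABAB w a b - occ ABAB w b a =
  (count_mem b y)%:R * ((count_mem b z)%:R - (count_mem b x)%:R).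
Proof.
move=> ba wE ax ay az /gauss_count; rewrite wE count_cat /= count_cat /=.
rewrite !(eq_sym a) (negbTE ba) => c2.
rewrite /occ (patC w a b) /pat wE filter_cat /= eqxx filter_cat /= eqxx.
rewrite !filter_two// /inst /=.
move: (count_mem b x) (count_mem b y) (count_mem b z) c2.
move=> [|[|[|c1]]] [|[|[|c2]]] [|[|[|c3]]] //= _.
all: by rewrite !eqseq_cons ?eqxx !(eq_sym a) ?(negbTE ba) /=; ring.
Qed.

Lemma map_nth_mid (T : Type) (d : T) (x y z : seq T) :
  [seq nth d (x ++ y ++ z) k | k <- iota (size x) (size y)] = y.
Proof.
rewrite map_nth_iota ?size_cat; last by lia.
by rewrite drop_size_cat// take_size_cat.
Qed.

Lemma arc_case (i j k l N : nat) :
  (i < k < j)%N -> (l < i)%N || (j < l < N)%N ->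
  if (l < k)%N then (l < i)%N else (j < l)%N.
Proof. by case: ifP; lia. Qed.

Lemma arc_bound (i j k l N : nat) :
  (i < k < j)%N -> (l < i)%N || (j < l < N)%N -> (j < N)%N ->
  (k < N)%N /\ (l < N)%N.
Proof. by lia. Qed.

Section SphericalLink.
Variable R : realType.

Lemma spherical_link (w : signed_word) a :
  spherical R w -> a \in word w -> link w a = 0.
Proof.
move=> [gamma gen [ts [ts_sorted ts_double ts_size ts_eq ts_sign]]] aw.
have [x [y [z [wE ax ay az]]]] : exists x y z : seq nat,
    [/\ word w = x ++ a :: y ++ a :: z, a \notin x, a \notin y & a \notin z].
  exact: split_twice (gauss_count aw).
set i := size x; set j := (i + (size y).+1)%N.
pose W k := nth 0%N (word w) k.
have sizeW : size (word w) = (j + (size z).+1)%N.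
  by rewrite wE size_cat /= size_cat /= /j /i; lia.
have mapx : [seq W k | k <- iota 0 i] = x.
  have := map_nth_mid 0%N [::] x (a :: y ++ a :: z); rewrite /= -wE; exact.
have mapy : [seq W k | k <- iota i.+1 (size y)] = y.
  have := map_nth_mid 0%N (rcons x a) y (a :: z);
  by rewrite cat_rcons -wE size_rcons.
have mapz : [seq W k | k <- iota j.+1 (size z)] = z.
  have := map_nth_mid 0%N (rcons (x ++ a :: y) a) z [::].
  by rewrite cats0 cat_rcons -catA /= -wE size_rcons size_cat.
have Wi : W i = a by rewrite /W wE nth_cat ltnn subnn.
have Wj : W j = a.
  by rewrite /W wE nth_cat /j ltnNge leq_addr /= addKn /= nth_cat ltnn subnn.
have lt_ts k l : (k < size ts)%N -> (l < size ts)%N -> (ts`_k < ts`_l) = (k < l)%N.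
  by move=> kN lN; exact: (lt_sorted_ltn_nth 0 ts_sorted).
have ts01 k : (k < size ts)%N -> 0 <= ts`_k < 1.
  by move=> /(mem_nth 0)/ts_double[u []].
have ts_inj k l : (k < size ts)%N -> (l < size ts)%N -> ts`_k = ts`_l -> k = l.
  by move=> kN lN /eqP; rewrite nth_uniq ?lt_sorted_uniq// => /eqP.
have [iN jN] : (i < size ts)%N /\ (j < size ts)%N by rewrite ts_size sizeW; lia.
have ij : (i < j)%N by rewrite /j; lia.
(* The crossings between the two loops: [k] runs over the positions between the two occurrences of
   [a], [l] over those outside. *)
pose P := [seq kl <- [seq (k, l) | k <- iota i.+1 (size y),
                                   l <- iota 0 i ++ iota j.+1 (size z)]
             | W kl.1 == W kl.2].
have PP k l : (k, l) \in P =
    [&& (i < k < j)%N, (l < i)%N || (j < l < size ts)%N & W k == W l].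
  rewrite mem_filter andbC /= andbA; congr (_ && _); apply/allpairsP/idP.
    move=> [[k' l'] /= [+ + [-> ->]]]; rewrite mem_cat !mem_iota ts_size sizeW /j; lia.
  move=> kl; exists (k, l); split=> //=; rewrite ?mem_cat !mem_iota; move: kl;
    rewrite ts_size sizeW /j; lia.
(* The second loop passes the base point, so positions before the first [a] are met one period
   later. *)
pose par (kl : nat * nat) :=
  (ts`_kl.1, if (kl.2 < kl.1)%N then ts`_kl.2 + 1 else ts`_kl.2).
pose X := [seq par kl | kl <- P].
have sumX : \sum_(z <- X)
  (if 0 < area (gamma z.1) (velocity gamma z.1) (velocity gamma z.2)
   then -1 else 1 : int) = 0.
  apply: (@sphere_crossing_sum _ _ gen ts`_i ts`_j).
  - by have /andP[] := ts01 _ iN.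
  - by rewrite lt_ts.
  - by have /andP[] := ts01 _ jN.
  - by apply/ts_eq => //; rewrite -/(W i) -/(W j) Wi Wj.
  - move=> _ /mapP[[k l] + ->]; rewrite PP => /and3P[ikj lij /eqP Wkl].
    have [kN lN] := arc_bound ikj lij jN.
    have gkl : gamma ts`_k = gamma ts`_l by apply/ts_eq.
    rewrite /par /= !lt_ts// ikj; split=> //.
      have /andP[l0 l1] := ts01 _ lN; have /andP[j0 j1] := ts01 _ jN.
      have /andP[i0 i1] := ts01 _ iN.
      case: ifP => lk.
        have li : ts`_l < ts`_i by rewrite lt_ts//; have := arc_case ikj lij; rewrite lk.
        rewrite ltrD2r li andbT; lra.
      have jl : ts`_j < ts`_l by rewrite lt_ts//; have := arc_case ikj lij; rewrite lk.
      rewrite jl /=; lra.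
    by case: ifP => _ //; rewrite (curve_closed gen).
  - move=> p q /andP[ip pj] /andP[jq qi] gpq.
    have [/andP[i0 i1] /andP[j0 j1]] := (ts01 _ iN, ts01 _ jN).
    have [q' [q01 gq' pq' qE]] : exists q', [/\ 0 <= q' < 1, gamma q' = gamma q, p != q'
        & (q' < ts`_i /\ q = q' + 1) \/ (ts`_j < q' /\ q = q')].
      have [q1|q1] := ltP q 1.
        exists q; split=> //; [lra| |by right].
        by rewrite lt_eqF//; lra.
      exists (q - 1); split; [lra| | |left; split; [lra|by rewrite subrK]].
        by rewrite -(curve_closed gen) subrK.
      by rewrite gt_eqF//; lra.
    have p01 : 0 <= p < 1 by lra.
    have /(nthP 0)[k kN kE] : p \in ts.
      by apply/ts_double; exists q'; split; rewrite // 1?eq_sym// gq'.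
    have /(nthP 0)[l lN lE] : q' \in ts.
      by apply/ts_double; exists p; split; rewrite // gq'.
    have Wkl : W k = W l.
      by apply/ts_eq => //; rewrite kE lE gq'.
    have ikj : (i < k < j)%N by rewrite -(lt_ts i k)// -(lt_ts k j)// kE ip.
    have [[li qE']|[jl qE']] := qE.
      rewrite -lE lt_ts// in li.
      apply/mapP; exists (k, l); first by rewrite PP ikj li Wkl eqxx.
      rewrite /par /= kE lE qE' (ltn_trans li)//; by case/andP: ikj.
    rewrite -lE lt_ts// in jl.
    apply/mapP; exists (k, l); first by rewrite PP ikj jl lN orbT Wkl eqxx.
    rewrite /par /= kE lE qE' ltnNge (ltnW (ltn_trans _ jl))//; by case/andP: ikj.
  - rewrite map_inj_in_uniq.
      apply/filter_uniq/allpairs_uniq;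
        [exact: iota_uniq| |by move=> [? ?] [? ?] _ _ [-> ->]].
      rewrite cat_uniq !iota_uniq andbT /=; apply/hasPn => l; rewrite !mem_iota /j; lia.
    move=> [k l] [k' l']; rewrite !PP => /and3P[kj lj _] /and3P[kj' lj' _] [].
    have [kN lN] := arc_bound kj lj jN.
    have [kN' lN'] := arc_bound kj' lj' jN.
    move=> /(ts_inj _ _ kN kN') <-.
    have [/andP[l0 l1] /andP[l0' l1']] := (ts01 _ lN, ts01 _ lN').
    case: ifP => _; case: ifP => _.
    - by move=> /addIr/(ts_inj _ _ lN lN') <-.
    - by move=> E; rewrite -E ltNge lerDr l0 in l1'.
    - by move=> E; rewrite E ltNge lerDr l0' in l1.
    - by move=> /(ts_inj _ _ lN lN') <-.
have : \sum_(z <- X) (if 0 < area (gamma z.1) (velocity gamma z.1) (velocity gamma z.2)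
   then -1 else 1 : int) =
  \sum_(kl <- P) (if (kl.2 < kl.1)%N then - eps w (W kl.1) else eps w (W kl.1)).
  rewrite big_map; apply: eq_big_seq => -[k l]; rewrite PP => /and3P[ikj lij /eqP Wkl] /=.
  have [kN lN] := arc_bound ikj lij jN.
  have gkl : gamma ts`_k = gamma ts`_l by apply/ts_eq.
  (* The sign of a letter takes the branch of its first occurrence first. For [l < k] this is the
     branch on the second loop, so the frame is exchanged and the sign reversed. *)
  case lk: (l < k)%N.
    rewrite (velocity_add1 gen) /eps Wkl /W (ts_sign l k); [|by rewrite lk kN|exact/esym].
    have : area (gamma ts`_l) (velocity gamma ts`_l) (velocity gamma ts`_k) != 0.
      by apply: area_neq0 => //; rewrite ?ts01//; rewrite lt_eqF// lt_ts.
    rewrite gkl area_anti oppr_eq0 oppr_gt0; move: (area _ _ _) => B B0.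
    by case: (ltgtP B 0) B0 => //; rewrite opprK.
  rewrite /eps /W (ts_sign k l)//.
  have := arc_case ikj lij; rewrite lk => jl; rewrite lN andbT.
  by apply: ltn_trans jl; case/andP: ikj.
rewrite sumX => /esym sumP.
pose F b := ((count_mem b z)%:R - (count_mem b x)%:R) * eps w b.
have cx c (e : int) : (count_mem c x)%:R * e =
    \sum_(l <- iota 0 i) (if c == W l then e else 0).
  by rewrite -[in LHS]mapx -big_count_mem big_map.
have cz c (e : int) : (count_mem c z)%:R * e =
    \sum_(l <- iota j.+1 (size z)) (if c == W l then e else 0).
  by rewrite -[in LHS]mapz -big_count_mem big_map.
(* For fixed [k], the sum over [l] counts the same letter in [z] with sign plus and in [x] with sign
   minus. *)
have {sumP}: \sum_(b <- [seq W k | k <- iota i.+1 (size y)]) F b = 0.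
  rewrite -[RHS]sumP big_filter [RHS]big_mkcond big_allpairs_dep big_map.
  apply: eq_big_seq => k; rewrite mem_iota addSnnS => /andP[ik kj].
  rewrite big_cat /F mulrBl -mulrN addrC cx cz; congr (_ + _).
    apply: eq_big_seq => l.
    by rewrite mem_iota /= => li; rewrite (ltn_trans li ik).
  apply: eq_big_seq => l.
  by rewrite mem_iota => /andP[jl _]; rewrite ltnNge (ltnW (ltn_trans kj jl)).
rewrite mapy.
move=> <-; rewrite (@big_undup_count _ _ (word w)); last first.
  by move=> b; rewrite wE mem_cat inE mem_cat => ->; rewrite !orbT.
rewrite /link big_mkcond; apply: eq_big_seq => b; rewrite mem_undup => bw.
have [->|ba] := eqVneq b a; first by rewrite (count_memPn ay) mul0r.
by rewrite (occ_ABAB_count ba wE)// mulrA.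
Qed.

End SphericalLink.

(** * Isomorphisms and shifts *)

Definition pairs (w : signed_word) (g : nat -> nat -> int) : int :=
  \sum_(a <- undup (word w)) \sum_(b <- undup (word w) | b != a) g a b.

Lemma mem_letters w a : (a \in letters w) = (a \in word w).
Proof. by rewrite /letters in_fset. Qed.

Lemma letters_delete (S : {fset nat}) w :
  letters (delete S w) = (letters w `\` S)%fset.
Proof. by apply/fsetP => a; rewrite in_fsetD !mem_letters mem_filter. Qed.

Lemma sign_prodE w : sign_prod w = \prod_(a <- letters w) eps w a.
Proof.
by rewrite /sign_prod big_mkcond; apply: eq_bigr => a _; rewrite /eps; case: ifP.
Qed.

(** As [0] comes first, [inst v a b] and [inst v b a] differ, so each subword arises from one
    ordered pair only. *)
Definition two_letters (v : seq nat) : bool :=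
  [&& head 1%N v == 0%N, 1%N \in v & all (fun i => (i == 0%N) || (i == 1%N)) v].

Lemma two_letters_mem v : two_letters v -> 0%N \in v /\ 1%N \in v.
Proof.
by case: v => // i v /and3P[/= /eqP-> -> _]; rewrite mem_head.
Qed.

Lemma two_letters_map v (f : nat -> nat) : two_letters v ->
  map f v = inst v (f 0%N) (f 1%N).
Proof.
case/and3P=> _ _ /allP h; apply/eq_in_map => i /h.
by case/orP => /eqP->.
Qed.

Lemma inst_neq v a b : two_letters v -> a != b -> inst v a b != inst v b a.
Proof.
case: v => [|i v] /and3P[]//= /eqP-> _ _ ab.
by rewrite /inst /= eqseq_cons negb_and ab.
Qed.

Lemma mem_inst v a b c : two_letters v -> (c \in inst v a b) = (c \in [:: a; b]).
Proof.
move=> /two_letters_mem[v0 v1]; apply/mapP/idP.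
  by move=> [i _ ->]; rewrite !inE; case: ifP; rewrite eqxx ?orbT.
by rewrite !inE => /orP[]/eqP->; [exists 0%N|exists 1%N].
Qed.

Lemma delete_pair w a b : a \in word w -> b \in word w ->
  word (delete (letters w `\` [fset a; b])%fset w) = pat w a b.
Proof.
move=> aw bw; apply: eq_in_filter => c cw.
by rewrite in_fsetD mem_letters cw andbT negbK !inE.
Qed.

(** A subword isomorphic to [v] corresponds to the pair [(a, b)] of letters in the roles of [0] and
    [1], its deleted set being the complement [D (a, b)]. *)
Lemma pairingE v w : two_letters v ->
  pairing v w = pairs w (fun a b => occ v w a b * (eps w a * eps w b)).
Proof.
move=> v2; set L := undup (word w).
pose Q := [seq ab <- [seq (a, b) | a <- L, b <- L]
            | (ab.2 != ab.1) && (pat w ab.1 ab.2 == inst v ab.1 ab.2)].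
have QP a b : (a, b) \in Q = [&& a \in word w, b \in word w, b != a
    & pat w a b == inst v a b].
  rewrite mem_filter andbC /=.
  have -> : ((a, b) \in [seq (a, b) | a <- L, b <- L]) = (a \in word w) && (b \in word w).
    rewrite -[a \in _]mem_undup -[b \in _]mem_undup.
    by apply/allpairsP/andP => [[[a' b'] /= [? ? [-> ->]]]//|[? ?]]; exists (a, b).
  by rewrite -andbA.
pose D (ab : nat * nat) := (letters w `\` [fset ab.1; ab.2])%fset.
transitivity (\sum_(ab <- Q) eps w ab.1 * eps w ab.2); last first.
  rewrite big_filter big_mkcond big_allpairs_dep; apply: eq_bigr => a _.
  rewrite [RHS]big_mkcond; apply: eq_bigr => b _; rewrite /occ.
  by case: (b != a) => //=; case: ifP => _; rewrite ?mul1r ?mul0r.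
transitivity (\sum_(S <- map D Q) sign_prod (delete S w)).
  rewrite /pairing -big_filter; apply: perm_big; apply: uniq_perm.
  - exact/filter_uniq/fset_uniq.
  - rewrite map_inj_in_uniq.
      apply/filter_uniq/allpairs_uniq; rewrite ?undup_uniq//.
      by move=> [? ?] [? ?] _ _ [-> ->].
    move=> [a b] [a' b']; rewrite !QP.
    move=> /and4P[aw bw ba /eqP p] /and4P[aw' bw' ba' /eqP p'] DE.
    have mem c : c \in word w -> (c \in [:: a; b]) = (c \in [:: a'; b']).
      move=> cw; have /fsetP/(_ c) := DE; rewrite !in_fsetD mem_letters cw !andbT !inE.
      by move/negb_inj.
    have := mem a aw; rewrite mem_head !inE => /esym/orP[]/eqP aE.
      subst a'; have := mem b bw; rewrite mem_seq2 eqxx orbT mem_seq2 (negbTE ba).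
      by move=> /esym/eqP->.
    subst b'; have := mem b bw; rewrite mem_seq2 eqxx orbT mem_seq2 (negbTE ba) orbF.
    move=> /esym/eqP bE; subst a'.
    by have := inst_neq v2 ba; rewrite -p -p' patC eqxx.
  - move=> S; rewrite mem_filter; apply/andP/mapP.
      move=> [/asboolP[f finj fE] SL].
      have [v0 v1] := two_letters_mem v2.
      pose a := f 0%N; pose b := f 1%N.
      have fE' : word (delete S w) = inst v a b by rewrite fE two_letters_map.
      have ab : b != a by apply/eqP => /(finj _ _ v1 v0).
      have memS c : (c \in word w) && (c \notin S) = (c \in [:: a; b]).
        by rewrite -(mem_inst a b c v2) -fE' mem_filter andbC.
      have aw : a \in word w by have := memS a; rewrite mem_head => /andP[].
      have bw : b \in word w by have := memS b; rewrite mem_seq2 eqxx orbT => /andP[].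
      have SE : S = D (a, b).
        apply/fsetP => c; rewrite in_fsetD mem_letters !inE.
        move: SL; rewrite fpowersetE => /fsubsetP/(_ c); rewrite mem_letters => SL.
        have := memS c; rewrite !inE; have [cS|cS] := boolP (c \in S).
          by rewrite SL// => /esym ->.
        by rewrite andbT => ->; case: (_ || _).
      exists (a, b) => //; rewrite QP aw bw ab; apply/eqP.
      by rewrite -fE' SE delete_pair.
    move=> [[a b] + ->]; rewrite QP => /and4P[aw bw ba /eqP pE]; split.
      apply/asboolP; exists (fun i => if i == 0%N then a else b); last first.
        by rewrite delete_pair.
      move=> i j; case/and3P: v2 => _ _ /allP v01 /v01 + /v01.
      by case/orP => /eqP-> /orP[]/eqP-> //= E; rewrite E eqxx in ba.
    by rewrite fpowersetE /D fsubsetDl.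
rewrite big_map; apply: eq_big_seq => -[a b]; rewrite QP => /and4P[aw bw ba _].
rewrite sign_prodE letters_delete /=.
have -> : (letters w `\` (letters w `\` [fset a; b]) = [fset a; b])%fset.
  apply/fsetP => c; rewrite !in_fsetD mem_letters !inE negb_and negbK andb_orl.
  rewrite andNb orbF; case: eqVneq => [->|_]; rewrite ?aw//=.
  by case: eqVneq => [->|_].
rewrite (perm_big [:: a; b]) /=; last first.
  apply: uniq_perm; [exact: fset_uniq|by rewrite /= mem_seq1 eq_sym ba|].
  by move=> c; rewrite !inE.
by rewrite !big_cons big_nil mulr1.
Qed.

Lemma pairing_AAE w : pairing_AA w = (size (undup (word w)))%:R.
Proof.
pose D a := (letters w `\ a)%fset.
transitivity (\sum_(S <- map D (undup (word w))) (1 : int)); last first.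
  by rewrite big_map big_const_seq count_predT iter_addr_0.
rewrite /pairing_AA -big_filter; apply: perm_big; apply: uniq_perm.
- exact/filter_uniq/fset_uniq.
- rewrite map_inj_in_uniq ?undup_uniq// => a b; rewrite !mem_undup => aw bw DE.
  apply/eqP; have /fsetP/(_ a) := DE; rewrite !in_fsetD1 mem_letters aw eqxx /= andbT.
  by move=> /esym/negbFE.
- move=> S; rewrite mem_filter /rank letters_delete fpowersetE; apply/andP/mapP.
    move=> [/cardfs1P[a aE] SL].
    have aw : a \in word w.
      by rewrite -mem_letters; have := fset11 a; rewrite -aE in_fsetD => /andP[].
    exists a; first by rewrite mem_undup.
    apply/fsetP => c; have /fsetP/(_ c) := aE; rewrite in_fsetD in_fset1 in_fsetD1.
    move=> <-; rewrite negb_and negbK andb_orl andNb orbF andb_idr//.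
    exact: (fsubsetP SL).
  move=> [a]; rewrite mem_undup => aw ->; split; last exact: fsubsetDl.
  apply/cardfs1P; exists a; apply/fsetP => c.
  rewrite in_fsetD in_fsetD1 in_fset1 negb_and negbK andb_orl andNb orbF.
  by rewrite andb_idr// => /eqP->; rewrite mem_letters.
Qed.

Section Isomorphic.
Variables (w w' : signed_word) (f : nat -> nat).
Hypothesis f_inj : {in word w &, injective f}.
Hypothesis wE : word w' = map f (word w).
Hypothesis minusE : {in word w, forall a, minus w' (f a) = minus w a}.

Lemma iso_undup : perm_eq (undup (word w')) (map f (undup (word w))).
Proof.
apply: uniq_perm; first exact: undup_uniq.
  rewrite map_inj_in_uniq ?undup_uniq// => a b.
  by rewrite !mem_undup; exact: f_inj.
move=> c; rewrite mem_undup wE; apply/mapP/mapP => -[a aw ->]; exists a => //.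
  by rewrite mem_undup.
by rewrite -mem_undup.
Qed.

Lemma iso_eps a : a \in word w -> eps w' (f a) = eps w a.
Proof. by move=> aw; rewrite /eps minusE. Qed.

Lemma iso_occ v a b : two_letters v -> a \in word w -> b \in word w ->
  occ v w' (f a) (f b) = occ v w a b.
Proof.
move=> v2 aw bw; rewrite /occ; congr (nat_of_bool _)%:R.
have -> : pat w' (f a) (f b) = map f (pat w a b).
  rewrite /pat wE filter_map; congr map; apply: eq_in_filter => c cw /=.
  by rewrite !(inj_in_eq f_inj).
have -> : inst v (f a) (f b) = map f (inst v a b).
  by rewrite /inst -map_comp; apply: eq_map => i /=; case: ifP.
have sub c : c \in pat w a b -> c \in word w by rewrite mem_filter => /andP[].
have sub' c : c \in inst v a b -> c \in word w.
  by rewrite mem_inst// !inE => /orP[]/eqP->.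
elim: (pat w a b) (inst v a b) sub sub' => [|c s IH] [|d t] //= sub sub'.
rewrite !eqseq_cons (inj_in_eq f_inj (sub _ (mem_head _ _)) (sub' _ (mem_head _ _))).
by rewrite IH// => e es; [apply: sub|apply: sub']; rewrite inE es orbT.
Qed.

Lemma iso_pairs g g' : {in word w &, forall a b, g' (f a) (f b) = g a b} ->
  pairs w' g' = pairs w g.
Proof.
move=> gE; rewrite /pairs (perm_big _ iso_undup) big_map.
apply: eq_big_seq => a; rewrite mem_undup => aw.
rewrite (perm_big _ iso_undup) big_map big_seq_cond [RHS]big_seq_cond.
apply: eq_big => b; rewrite mem_undup; last by case/andP=> bw _; exact: gE.
by have [bw|//] := boolP (b \in _); rewrite (inj_in_eq f_inj).
Qed.

Lemma iso_link a : a \in word w -> link w' (f a) = link w a.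
Proof.
move=> aw; rewrite /link (perm_big _ iso_undup) big_map big_seq_cond [RHS]big_seq_cond.
have E := @iso_occ ABAB _ _ isT.
apply: eq_big => b; rewrite mem_undup.
  by have [bw|//] := boolP (b \in _); rewrite (inj_in_eq f_inj).
by case/andP=> bw _; rewrite iso_eps// !E.
Qed.

End Isomorphic.

(** * Effect of a shift of the first letter *)

Section Shift.
Variables (w w' : signed_word) (c : nat) (x : seq nat).
Hypothesis wE : word w = c :: x.
Hypothesis w'E : word w' = rcons x c.
Hypothesis minusE : {in word w, forall b,
  minus w' b = if b == c then ~~ minus w b else minus w b}.

Let L := undup (word w).

Let cw : c \in word w.
Proof. by rewrite wE mem_head. Qed.

Lemma shift_undup : perm_eq (undup (word w')) L.
Proof. by rewrite perm_undup// => a; rewrite wE w'E mem_rcons. Qed.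

Lemma shift_eps b : b \in word w -> eps w' b = if b == c then - eps w b else eps w b.
Proof.
by move=> bw; rewrite /eps minusE//; case: eqP; case: (minus w b); rewrite ?opprK.
Qed.

Lemma shift_pat a b : a != c -> b != c -> pat w' a b = pat w a b.
Proof.
move=> ac bc; rewrite /pat w'E wE filter_rcons /= !(eq_sym c).
by rewrite (negbTE ac) (negbTE bc).
Qed.

Lemma shift_patc b : b \in word w -> b != c -> exists2 y,
  pat w c b = c :: y /\ pat w' c b = rcons y c &
  y \in [:: [:: c; b; b]; [:: b; c; b]; [:: b; b; c]].
Proof.
move=> bw bc; exists [seq k <- x | (k == c) || (k == b)].
  by rewrite /pat w'E wE filter_rcons /= eqxx.
have c1 : count_mem c x = 1%N by have := gauss_count cw; rewrite wE /= eqxx => -[].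
have b2 : count_mem b x = 2%N.
  by have := gauss_count bw; rewrite wE /= eq_sym (negbTE bc).
have cx : c \in x by rewrite -has_pred1 has_count c1.
case/splitPr: cx b2 c1 => x1 x2; rewrite !count_cat /= eqxx (eq_sym c b) (negbTE bc).
move=> b2 c1; have [cx1 cx2] : c \notin x1 /\ c \notin x2.
  have : (1 + (count_mem c x1 + count_mem c x2) == 1)%N by rewrite addnCA c1.
  rewrite add1n eqSS addn_eq0 => /andP[/eqP n1 /eqP n2].
  by rewrite -!has_pred1 !has_count n1 n2.
rewrite filter_cat /= eqxx !filter_two//.
move: (count_mem b x1) (count_mem b x2) b2 => [|[|[|n1]]] [|[|[|n2]]] //= _.
- by rewrite mem_head.
- by rewrite inE mem_head orbT.
- by rewrite 2!inE mem_head !orbT.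
Qed.

(** The shift turns ccbb into cbbc, cbcb into bcbc and cbbc into bbcc. The reversed sign of the AABB
    - ABBA count is compensated by that of [eps w c]. *)
Lemma shift_occ b : b \in word w -> b != c ->
  [/\ occ ABAB w b c = 0,
      occ ABAB w' c b = 0,
      occ ABAB w' b c = occ ABAB w c b &
      (occ AABB w c b - occ ABBA w c b) + (occ AABB w b c - occ ABBA w b c) =
      - ((occ AABB w' c b - occ ABBA w' c b) + (occ AABB w' b c - occ ABBA w' b c))].
Proof.
move=> bw bc; have [y [pw pw'] yE] := shift_patc bw bc.
rewrite /occ !(patC _ c b) pw pw' /inst /=; move: yE; rewrite !inE.
by case/or3P => /eqP->; rewrite /= !eqseq_cons ?eqxx !(eq_sym c) ?(negbTE bc) /=;
  split; ring.
Qed.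

(** The shift makes [c] last instead of first among the letters linked with it, which negates
    [link w c]. In [link w a] for [a != c], this change of order cancels against the new sign of
    [c]. *)
Lemma shift_link a : a \in word w -> link w' a = if a == c then - link w a else link w a.
Proof.
move=> aw; rewrite /link (perm_big _ shift_undup); case: eqVneq => [->|ac].
  rewrite -sumrN big_seq_cond [RHS]big_seq_cond; apply: eq_bigr => b.
  rewrite mem_undup => /andP[bw bc]; have [e1 e2 e3 _] := shift_occ bw bc.
  by rewrite shift_eps// (negbTE bc) e1 e2 e3; ring.
rewrite big_seq_cond [RHS]big_seq_cond; apply: eq_bigr => b.
rewrite mem_undup => /andP[bw ba]; rewrite shift_eps//.
have [->|bc] := eqVneq b c.
  by have [e1 e2 e3 _] := shift_occ aw ac; rewrite e1 e2 e3; ring.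
by rewrite /occ !shift_pat.
Qed.

Lemma pairs_split g : pairs w g =
  \sum_(b <- L | b != c) (g c b + g b c) +
  \sum_(a <- L | a != c) \sum_(b <- L | (b != a) && (b != c)) g a b.
Proof.
have cL : c \in L by rewrite mem_undup.
have uL : uniq L := undup_uniq _.
rewrite /pairs -/L (bigD1_seq c)//= big_split /= -addrA; congr (_ + _).
rewrite -big_split; apply: eq_bigr => a ac.
by rewrite big_mkcond (bigD1_seq c)//= eq_sym ac -big_mkcondr; congr (_ + _);
   apply: eq_bigl => b; rewrite andbC.
Qed.

Lemma shift_pairs g : pairs w' g = pairs w g.
Proof.
rewrite /pairs (perm_big _ shift_undup); apply: eq_bigr => a _.
by rewrite (perm_big _ shift_undup).
Qed.

Lemma shift_AABB_ABBA :
  pairing AABB w' - pairing ABBA w' = pairing AABB w - pairing ABBA w.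
Proof.
have diffE (u : signed_word) : pairing AABB u - pairing ABBA u =
    pairs u (fun a b => (occ AABB u a b - occ ABBA u a b) * (eps u a * eps u b)).
  rewrite !pairingE// /pairs -sumrB; apply: eq_bigr => a _.
  by rewrite -sumrB; apply: eq_bigr => b _; rewrite mulrBl.
rewrite !diffE shift_pairs !pairs_split; congr (_ + _).
  rewrite big_seq_cond [RHS]big_seq_cond; apply: eq_bigr => b.
  rewrite mem_undup => /andP[bw bc]; have [_ _ _ E] := shift_occ bw bc.
  rewrite !shift_eps// eqxx (negbTE bc).
  transitivity (((occ AABB w c b - occ ABBA w c b) +
                 (occ AABB w b c - occ ABBA w b c)) * (eps w c * eps w b)).
    by rewrite E; ring.
  by ring.
rewrite big_seq_cond [RHS]big_seq_cond; apply: eq_bigr => a /andP[aw ac].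
rewrite big_seq_cond [RHS]big_seq_cond; apply: eq_bigr => b /and3P[bw ba bc].
move: aw bw; rewrite !mem_undup => aw bw.
by rewrite !shift_eps// (negbTE ac) (negbTE bc) /occ !shift_pat.
Qed.

(** The pairs containing [c] contribute [eps w c * link w c] before the shift and the opposite after
    it. *)
Lemma shift_ABAB : link w c = 0 -> pairing ABAB w' = pairing ABAB w.
Proof.
move=> lk; rewrite !pairingE// shift_pairs !pairs_split; congr (_ + _).
  transitivity (- eps w c * link w c); [rewrite /link|transitivity (eps w c * link w c)].
  - rewrite mulr_sumr big_seq_cond [RHS]big_seq_cond; apply: eq_bigr => b.
    rewrite mem_undup => /andP[bw bc]; have [e1 e2 e3 _] := shift_occ bw bc.
    by rewrite !shift_eps// eqxx (negbTE bc) e1 e2 e3; ring.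
  - by rewrite lk !mulr0.
  rewrite /link mulr_sumr big_seq_cond [RHS]big_seq_cond; apply: eq_bigr => b.
  rewrite mem_undup => /andP[bw bc]; have [e1 e2 e3 _] := shift_occ bw bc.
  by rewrite e1; ring.
rewrite big_seq_cond [RHS]big_seq_cond; apply: eq_bigr => a /andP[aw ac].
rewrite big_seq_cond [RHS]big_seq_cond; apply: eq_bigr => b /and3P[bw ba bc].
move: aw bw; rewrite !mem_undup => aw bw.
by rewrite !shift_eps// (negbTE ac) (negbTE bc) /occ !shift_pat.
Qed.

Lemma shift_AA : pairing_AA w' = pairing_AA w.
Proof. by rewrite !pairing_AAE (perm_size shift_undup). Qed.

End Shift.

Definition counts (w : signed_word) : int * int * int :=
  (pairing AABB w - pairing ABBA w, pairing ABAB w, pairing_AA w).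

Lemma iso_counts w w' : isomorphic w w' -> counts w = counts w'.
Proof.
move=> [f [f_inj wE minusE]]; have pE v : two_letters v -> pairing v w' = pairing v w.
  move=> v2; rewrite !pairingE//; apply: (iso_pairs f_inj wE) => a b aw bw.
  by rewrite (iso_occ f_inj wE)// !(iso_eps minusE).
rewrite /counts !pE// !pairing_AAE.
by rewrite (perm_size (iso_undup f_inj wE)) size_map.
Qed.

Definition balanced (w : signed_word) : Prop := {in word w, forall a, link w a = 0}.

(** The intermediate words of a cyclic equivalence are not known to be spherical. The induction
    therefore carries [balanced], which both moves preserve in both directions. *)
Lemma cyclic_counts w w' : cyclic_equiv w w' ->
  (balanced w <-> balanced w') /\ (balanced w -> counts w = counts w').
Proof.
elim=> {w w'} [w w' iso|w w' sh|w w' _ [IH1 IH2]|w w' w'' _ [IH1 IH2] _ [IH3 IH4]].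
- split; last by move=> _; exact: iso_counts.
  have [f [f_inj wE minusE]] := iso; split=> [gw a|gw' a aw].
    by rewrite wE => /mapP[b bw ->]; rewrite (iso_link f_inj wE minusE)//; exact: gw.
  rewrite -(iso_link f_inj wE minusE)//; apply: gw'; rewrite wE; exact: map_f.
- have [c [x [wE w'E minusE]]] := sh.
  have mem a : (a \in word w') = (a \in word w) by rewrite wE w'E mem_rcons.
  have lk := shift_link wE w'E minusE; split; first split=> [gw a|gw' a aw].
  + by rewrite mem => aw; rewrite lk//; case: ifP; rewrite gw ?oppr0.
  + have := gw' a; rewrite mem lk// => /(_ aw); case: ifP => // _ /eqP.
    by rewrite oppr_eq0 => /eqP.
  + move=> gw; rewrite /counts (shift_AABB_ABBA wE w'E minusE) (shift_AA wE w'E).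
    by rewrite (shift_ABAB wE w'E minusE)//; apply: gw; rewrite wE mem_head.
- by split=> [|gw]; [split=> /IH1|apply/esym/IH2/IH1].
- split; first by split=> [/IH1/IH3|/IH3/IH1].
  by move=> gw; rewrite IH2//; apply/IH4/IH1.
Qed.

Lemma spherical_counts (R : realType) w w' :
  spherical R w -> cyclic_equiv w w' -> counts w = counts w'.
Proof. by move=> sw /cyclic_counts[_]; apply=> a; exact: spherical_link sw. Qed.

(** * Degree *)

Lemma signed_word_eq w w' : word w = word w' -> minus w = minus w' -> w = w'.
Proof.
case: w => s m g; case: w' => s' m' g' /= ss mm; subst s' m'.
by rewrite (bool_irrelevance g g').
Qed.

Lemma big_fpowerset1 (G : zmodType) (A : {fset nat}) (a : nat)
    (F : {fset nat} -> G) : a \in A ->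
  \sum_(S <- fpowerset A) F S =
  \sum_(S <- fpowerset (A `\ a)%fset) F S +
  \sum_(S <- fpowerset (A `\ a)%fset) F (a |` S)%fset.
Proof.
move=> aA; rewrite (bigID (fun S : {fset nat} => a \notin S)) /=; congr (_ + _).
  rewrite -big_filter; apply: perm_big; apply: uniq_perm.
  - exact/filter_uniq/fset_uniq.
  - exact: fset_uniq.
  - by move=> S; rewrite mem_filter !fpowersetE fsubsetD1 andbC.
transitivity (\sum_(S <- [seq (a |` T)%fset | T <- fpowerset (A `\ a)%fset]) F S);
  last first.
  by rewrite big_map.
rewrite -big_filter; apply: perm_big; apply: uniq_perm.
- exact/filter_uniq/fset_uniq.
- rewrite map_inj_in_uniq ?fset_uniq// => S T; rewrite !fpowersetE !fsubsetD1.
  move=> /andP[_ aS] /andP[_ aT] E.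
  by rewrite -(fsetU1K aS) -(fsetU1K aT) E.
move=> S; rewrite mem_filter negbK fpowersetE; apply/andP/mapP.
  move=> [aS SA]; exists (S `\ a)%fset; last by rewrite fsetD1K.
  by rewrite fpowersetE fsetSD.
move=> [T]; rewrite fpowersetE fsubsetD1 => /andP[TA aT] ->; split; first exact: fset1U1.
by rewrite fsubUset fsub1set aA.
Qed.

Section Subwords.
Variables (G : zmodType) (phi : signed_word -> G).

Definition subword_sum (w : signed_word) : G :=
  \sum_(S <- fpowerset (letters w)) phi (delete S w).

(** Each singular letter subtracts the subwords that lack it, so the subwords containing all
    singular letters remain. *)
Lemma sing_ext_subword_sum s w : uniq s -> {subset s <= word w} ->
  sing_ext subword_sum s w =
  \sum_(S <- fpowerset (letters w `\` [fset x in s])%fset) phi (delete S w).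
Proof.
elim: s w => [|a s IH] w /=.
  move=> _ _; rewrite (_ : [fset x in _]%fset = fset0) ?fsetD0//.
  by apply/fsetP => x; rewrite !inE.
move=> /andP[as_ us] sw.
have aw : a \in word w by apply: sw; rewrite mem_head.
have ssw : {subset s <= word w} by move=> b bs; apply: sw; rewrite inE bs orbT.
rewrite !IH//; last first.
  move=> b bs; rewrite mem_filter ssw// andbT inE.
  by apply: contraNneq as_ => <-.
have aA : a \in (letters w `\` [fset x in s])%fset.
  by rewrite in_fsetD mem_letters aw inE as_.
rewrite (big_fpowerset1 _ aA).
have -> : (letters w `\` [fset x in s] `\ a = letters w `\` [fset x in a :: s])%fset.
  by apply/fsetP => b; rewrite !inE negb_or andbA.
have -> : (letters (delete [:: a] w) `\` [fset x in s] =
    letters w `\` [fset x in a :: s])%fset.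
  apply/fsetP => b; rewrite !in_fsetD !mem_letters mem_filter !inE negb_or.
  by rewrite andbA [in RHS](andbC (b != a)).
apply/eqP; rewrite subr_eq addrC; apply/eqP; rewrite [RHS]addrC; congr (_ + _).
apply: eq_bigr => S _; congr phi; apply: signed_word_eq => //=.
rewrite -filter_predI; apply: eq_filter => b /=.
by rewrite !inE negb_or andbC.
Qed.

Lemma degree_subword_sum m : (forall w, (m < rank w)%N -> phi w = 0) ->
  degree_at_most subword_sum m.
Proof.
move=> phi0 w s us sw ms; rewrite sing_ext_subword_sum// big_seq big1// => S.
rewrite fpowersetE => SL; apply: phi0; rewrite /rank letters_delete.
apply: (leq_trans ms).
have -> : size s = #|` [fset x in s]%fset| by rewrite card_fseq undup_id.
apply/fsubset_leq_card/fsubsetP => b; rewrite in_fset /= => bs.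
rewrite in_fsetD mem_letters sw// andbT; apply: contraL bs => bS.
by have /fsubsetP/(_ _ bS) := SL; rewrite !inE => /andP[].
Qed.

End Subwords.

Lemma eq_sing_ext (G : zmodType) (u v : signed_word -> G) s w :
  u =1 v -> sing_ext u s w = sing_ext v s w.
Proof. by move=> uv; elim: s w => //= a s IH w; rewrite !IH. Qed.

Lemma renaming_rank v w : two_letters v -> renaming v (word w) -> rank w = 2%N.
Proof.
move=> v2 [f finj fE].
have [v0 v1] := two_letters_mem v2.
have ab : f 0%N != f 1%N by apply/eqP => /(finj _ _ v0 v1).
rewrite /rank (_ : letters w = [fset f 0%N; f 1%N]%fset) ?cardfs2 ?ab//.
by apply/fsetP => c; rewrite mem_letters fE two_letters_map// mem_inst// !inE.
Qed.

Section Quadratic.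
Variables c1 c2 c3 c4 : rat.

(** The common form of the three Arnold invariants. *)
Definition quad (w : signed_word) : rat :=
  c1 * (pairing AABB w - pairing ABBA w)%:~R + c2 * (pairing ABAB w)%:~R +
  c3 * (pairing_AA w)%:~R + c4.

Let pterm (v : seq nat) (w : signed_word) : int :=
  if `[< renaming v (word w) >] then sign_prod w else 0.

(** The contribution of a single subword; the constant [c4] is carried by the empty one. *)
Let phi (w : signed_word) : rat :=
  c1 * (pterm AABB w - pterm ABBA w)%:~R + c2 * (pterm ABAB w)%:~R +
  c3 * (rank w == 1%N)%:R + c4 * (rank w == 0%N)%:R.

Lemma quad_subword_sum w : quad w = subword_sum phi w.
Proof.
have pE v : pairing v w = \sum_(S <- fpowerset (letters w)) pterm v (delete S w).
  by rewrite /pairing big_mkcond.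
rewrite /subword_sum /quad /phi !big_split /= -!mulr_sumr; congr (_ + _ + _ + _).
- by rewrite !pE -sumrB rmorph_sum.
- by rewrite pE rmorph_sum.
- rewrite /pairing_AA big_mkcond rmorph_sum; congr (_ * _).
  by apply: eq_bigr => S _; case: ifP.
- rewrite -[LHS]mulr1; congr (_ * _).
  rewrite (bigD1_seq (letters w)) ?fset_uniq ?fpowersetE//= big_seq_cond big1.
    by rewrite addr0 /rank letters_delete fsetDv cardfs0.
  move=> S /andP[]; rewrite fpowersetE => SL SN.
  rewrite /rank letters_delete cardfs_eq0 fsetD_eq0.
  by have [LS|//] := boolP (letters w `<=` S)%fset; rewrite eqEfsubset SL LS in SN.
Qed.

Lemma phi_rank w : (2 < rank w)%N -> phi w = 0.
Proof.
move=> w3; have p0 v : two_letters v -> pterm v w = 0.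
  move=> v2; rewrite /pterm; case: asboolP => // /(renaming_rank v2) r2.
  by rewrite r2 in w3.
rewrite /phi !p0// !gtn_eqF ?(ltn_trans _ w3)//.
by rewrite subrr !mulr0z !mulr0n !mulr0 !addr0.
Qed.

Lemma quad_degree : degree_at_most quad 2.
Proof.
move=> w s us sw ms; rewrite (eq_sing_ext _ _ quad_subword_sum).
exact: (degree_subword_sum phi_rank us sw ms).
Qed.

Definition wAABB := @SignedWord AABB (fun=> false) isT.

(** With both letters singular only the whole word remains, so the degree is not below 2 when
    [c1 != 0]. *)
Lemma quad_AABB : sing_ext quad [:: 0; 1]%N wAABB = c1.
Proof.
rewrite (eq_sing_ext _ _ quad_subword_sum) sing_ext_subword_sum//; last first.
  by move=> a; rewrite !inE => /orP[]/eqP->.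
have -> : (letters wAABB `\` [fset x in [:: 0; 1]%N] = fset0)%fset.
  by apply/fsetP => a; rewrite in_fsetD mem_letters !inE; do 2!case: (_ == _).
rewrite fpowerset0 big_seq_fset1.
have -> : delete fset0 wAABB = wAABB by apply: signed_word_eq.
have r2 : rank wAABB = 2%N.
  rewrite /rank (_ : letters wAABB = [fset 0%N; 1%N]%fset) ?cardfs2//.
  by apply/fsetP => a; rewrite mem_letters !inE; do 2!case: (_ == _).
have t1 : pterm AABB wAABB = 1.
  rewrite /pterm /sign_prod big_pred0// asboolT//.
  by exists id.
have t2 : pterm ABBA wAABB = 0.
  by rewrite /pterm asboolF// => -[f _ /= [<- <-]].
have t3 : pterm ABAB wAABB = 0.
  by rewrite /pterm asboolF// => -[f _ /= [<- <-]].
by rewrite /phi r2 t1 t2 t3 /=; ring.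
Qed.

Lemma quad_has_degree : c1 != 0 -> has_degree quad 2.
Proof.
move=> c10; split; first exact: quad_degree.
move=> k qk; rewrite leqNgt; apply/negP => k2.
have := qk wAABB [:: 0; 1]%N isT _ k2; rewrite quad_AABB => c1E.
by move/eqP: c10; apply; apply: c1E => a; rewrite !inE => /orP[]/eqP->.
Qed.

Lemma quad_invariant (R : realType) : invariant R quad.
Proof.
split=> [w w' /iso_counts|w w' sw _ /(spherical_counts sw)].
  by rewrite /quad => -[-> -> ->].
by rewrite /quad => -[-> -> ->].
Qed.

End Quadratic.

(** * The Arnold invariants and the failure of universality *)

Lemma qval_sing_ext (u : signed_word -> quarterZ) s w :
  qval (sing_ext u s w) = sing_ext (fun w => qval (u w)) s w.
Proof. by elim: s w => //= a s IH w; rewrite -!IH. Qed.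

Lemma quad_finite_type (R : realType) (u : signed_word -> quarterZ) c1 c2 c3 c4 :
  c1 != 0 -> (forall w, qval (u w) = quad c1 c2 c3 c4 w) ->
  finite_type_invariant R u 2.
Proof.
move=> c10 uE; have sE s w : qval (sing_ext u s w) = sing_ext (quad c1 c2 c3 c4) s w.
  by rewrite qval_sing_ext; exact: eq_sing_ext.
have degE m : degree_at_most u m <-> degree_at_most (quad c1 c2 c3 c4) m.
  split=> H w s us sw ms; first by rewrite -sE H.
  by apply: val_inj; rewrite /= sE H.
have [inv_iso inv_cyc] := quad_invariant c1 c2 c3 c4 R.
have [deg2 degmin] := quad_has_degree c2 c3 c4 c10.
split; split.
- by move=> w w' ww'; apply: val_inj; rewrite /= !uE; exact: inv_iso.
- by move=> w w' sw sw' ww'; apply: val_inj; rewrite /= !uE; exact: inv_cyc.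
- exact/degE.
- by move=> k /degE/degmin.
Qed.

Lemma Jplus_quad w : Jplus_rat w = quad 1 (- 3) (- (1 / 2)) (1 / 2) w.
Proof. by rewrite /Jplus_rat /quad; ring. Qed.

Lemma Jminus_quad w : Jminus_rat w = quad 1 (- 3) (- (3 / 2)) (1 / 2) w.
Proof. by rewrite /Jminus_rat /quad; ring. Qed.

Lemma St_quad w : St_rat w = quad (- (1 / 2)) (1 / 2) (1 / 4) (- (1 / 4)) w.
Proof. by rewrite /St_rat /quad; ring. Qed.

Definition wAA := @SignedWord [:: 0; 0]%N (fun=> false) isT.

Lemma quad_AA c1 c2 c3 c4 : quad c1 c2 c3 c4 wAA = c3 + c4.
Proof.
have p0 v : two_letters v -> pairing v wAA = 0.
  by move=> v2; rewrite pairingE// /pairs /= !big_cons !big_nil.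
by rewrite /quad !p0// pairing_AAE /= subrr !mulr0z !mulr0 mulr1 !add0r.
Qed.

Lemma quarterP : - (1 / 4) \in quarter_int.
Proof. by apply: (@quarter_int_comb _ (-1)); field. Qed.

(** The values at AA are [0], [-1] and [0], and [-1] is four times [- (1 / 4)]. *)
Lemma arnold_AA : exists x, arnold wAA = x *+ 4.
Proof.
exists (0, QuarterZ quarterP, 0).
transitivity ((0 : quarterZ) *+ 4, QuarterZ quarterP *+ 4, (0 : quarterZ) *+ 4) => //.
rewrite /arnold mul0rn; congr (_, _, _); apply: val_inj.
- by rewrite /= Jplus_quad quad_AA; field.
- by rewrite [RHS](raddfMn \val) /= Jminus_quad quad_AA; field.
- by rewrite /= St_quad quad_AA; field.
Qed.

Lemma constant_degree m : degree_at_most (fun=> 1 : int) m.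
Proof.
move=> w [//|a s] _ _ _ /=.
suff : forall w w', sing_ext (fun=> 1 : int) s w = sing_ext (fun=> 1 : int) s w'.
  by move=> E; rewrite (E w (delete [:: a] w)) subrr.
elim: s => //= b s IH {}w w'.
by rewrite (IH w w') (IH (delete [:: b] w) (delete [:: b] w')).
Qed.

Theorem theorem7p3 (R : realType) :
  [/\ finite_type_invariant R Jplus 2,
      finite_type_invariant R Jminus 2,
      finite_type_invariant R St 2 &
      ~ universal R arnold 2].
Proof.
split.
- by apply: (quad_finite_type _ (u := Jplus) _ Jplus_quad).
- by apply: (quad_finite_type _ (u := Jminus) _ Jminus_quad).
- by apply: (quad_finite_type _ (u := St) _ St_quad).
move=> univ.
have [|f /(_ wAA)] := univ int (fun=> 1) _ (@constant_degree 2); first by split.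
(* Additivity of [f] would give [1 = 4 * f x] in the integers. *)
have [x ->] := arnold_AA; rewrite raddfMn => fE.
suff : (4 %| 1)%Z by [].
by apply/dvdzP; exists (f x); rewrite [LHS]fE mulr_natr.
Qed.
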